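(* Every Poisson manifold $M$ with Poisson bivector $\Pi$ has a linear contravariant connection whose contravariant derivative $D$ satisfies $D\Pi=0$.
   Context: For a Poisson manifold $(M,\Pi)$ let $\#:T^*M\to TM$ be defined by $\beta(\#\alpha)=\Pi(\alpha,\beta)$. A linear contravariant connection on $M$ is determined by its contravariant derivative: for each $\alpha\in\Omega^1(M)$ an $\mathbb R$-linear operator $D_\alpha:\Omega^1(M)\to\Omega^1(M)$ such that $D_{f_1\alpha_1+f_2\alpha_2}=f_1D_{\alpha_1}+f_2D_{\alpha_2}$ and $D_\alpha(f\beta)=fD_\alpha\beta+\#\alpha(f)\beta$ for all $f,f_i\in C^\infty(M)$ and $\alpha,\alpha_i,\beta\in\Omega^1(M)$. It extends to all tensor fields: $D_\alpha f=\#\alpha(f)$ on functions, $\langle D_\alpha X,\beta\rangle=\#\alpha(\langle X,\beta\rangle)-\langle X,D_\alpha\beta\rangle$ on vector fields, and as a derivation in general; in particular $(D_\alpha\Pi)(\beta,\gamma)=\#\alpha(\Pi(\beta,\gamma))-\Pi(D_\alpha\beta,\gamma)-\Pi(\beta,D_\alpha\gamma)$. $D\Pi=0$ means $D_\alpha\Pi=0$ for all $\alpha$. *)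

(* Defs.v *)
From HB Require Import structures.
From mathcomp Require Import all_boot all_order all_algebra.
From mathcomp Require Import all_classical all_reals all_analysis.
From mathcomp Require Import ring.

Set Implicit Arguments.
Unset Strict Implicit.
Unset Printing Implicit Defensive.

Import Order.TTheory GRing.Theory Num.Theory.
Import numFieldNormedType.Exports.

Local Open Scope classical_set_scope.
Local Open Scope ring_scope.

Section Smooth.
Variables (R : realType) (n : nat).
Implicit Types (U : set 'rV[R]_n) (f g : 'rV[R]_n -> R).

(* C^k on an open set U: all iterated partial derivatives of order <= k exist
   and are continuous on U. *)
Fixpoint Ck (k : nat) U f : Prop :=
  {in U, continuous f} /\
  match k with
  | 0 => True
  | k'.+1 => forall i : 'I_n,
      {in U, forall x, derivable f x (delta_mx 0 i)} /\
      Ck k' U (fun x => 'D_(delta_mx 0 i) f x)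
  end.

Definition smooth_on U f : Prop := forall k, Ck k U f.

Lemma Ck_continuous k U f : Ck k U f -> {in U, continuous f}.
Proof. by case: k => [|k] []. Qed.

Lemma CkW k U f : Ck k.+1 U f -> Ck k U f.
Proof.
elim: k f => [|k IH] f [fc fk]; first by split.
by split=> // i; have [fd /IH] := fk i.
Qed.

Lemma Ck_ext k U f g : open U -> {in U, f =1 g} -> Ck k U f -> Ck k U g.
Proof.
move=> oU; elim: k f g => [|k IH] f g fg [fc fk].
all: have E x : x \in U -> \forall y \near x, f y = g y by
  move=> xU; apply: filterS (open_nbhs_nbhs (conj oU (set_mem xU))) => y;
  move=> /mem_set /fg.
all: have gc : {in U, continuous g} by
  move=> x xU; rewrite /continuous_at -(fg _ xU);
  exact: cvg_trans (near_eq_cvg (E x xU)) (fc x xU).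
  by split.
split=> // i; have [fd fk'] := fk i; split.
  by move=> x xU; apply: near_eq_derivable (fd x xU); exact: E.
by apply: IH fk' => x xU; apply: near_eq_derive; exact: E.
Qed.

Lemma Ck_cst k U (c : R) : Ck k U (cst c).
Proof.
elim: k c => [|k IH] c; split=> //.
- by move=> x _; exact: cst_continuous.
- by move=> x _; exact: cst_continuous.
move=> i; split; first by move=> x _; exact: derivable_cst.
suff -> : (fun x => 'D_(delta_mx 0 i) (cst c : 'rV[R]_n -> R) x) = cst (0 : R) by exact: IH.
by apply/funext => x; rewrite derive_cst.
Qed.

Lemma CkD k U f g : open U -> Ck k U f -> Ck k U g -> Ck k U (f \+ g).
Proof.
move=> oU; elim: k f g => [|k IH] f g [fc fk] [gc gk].
  by split=> // x xU; apply: continuousD; [exact: fc|exact: gc].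
split; first by move=> x xU; apply: continuousD; [exact: fc|exact: gc].
move=> i; have [fd fk'] := fk i; have [gd gk'] := gk i; split.
  by move=> x xU; apply: derivableD; [exact: fd|exact: gd].
apply: Ck_ext (IH _ _ fk' gk') => // x xU /=.
by rewrite deriveD //; [exact: fd|exact: gd].
Qed.

Lemma CkM k U f g : open U -> Ck k U f -> Ck k U g -> Ck k U (f \* g).
Proof.
move=> oU; elim: k f g => [|k IH] f g Cf Cg.
  split=> // x xU.
  by apply: continuousM; [exact: Ck_continuous Cf _ xU|exact: Ck_continuous Cg _ xU].
split.
  move=> x xU.
  by apply: continuousM; [exact: Ck_continuous Cf _ xU|exact: Ck_continuous Cg _ xU].
move=> i; have [fd fk] := Cf.2 i; have [gd gk] := Cg.2 i; split.
  by move=> x xU; apply: derivableM; [exact: fd|exact: gd].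
have H := CkD oU (IH _ _ (CkW Cf) gk) (IH _ _ (CkW Cg) fk).
apply: Ck_ext H => // x xU /=.
by rewrite deriveM //; [exact: fd|exact: gd].
Qed.

End Smooth.

(* chart_map and chart_inv are total functions; only their restrictions to
   chart_dom and chart_img are meaningful. *)
Record chart (R : realType) (n : nat) (T : topologicalType) := Chart {
  chart_dom : set T;
  chart_img : set 'rV[R]_n;
  chart_map : T -> 'rV[R]_n;
  chart_inv : 'rV[R]_n -> T;
  chart_dom_open : open chart_dom;
  chart_img_open : open chart_img;
  chart_mapP : {homo chart_map : x / chart_dom x >-> chart_img x};
  chart_invP : {homo chart_inv : y / chart_img y >-> chart_dom y};
  chart_mapK : {in chart_dom, cancel chart_map chart_inv};
  chart_invK : {in chart_img, cancel chart_inv chart_map};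
  chart_map_continuous : {in chart_dom, continuous chart_map};
  chart_inv_continuous : {in chart_img, continuous chart_inv} }.

Definition chart_compatible (R : realType) (n : nat) (T : topologicalType)
    (c c' : chart R n T) : Prop :=
  forall i : 'I_n,
    smooth_on (chart_img c `&` chart_inv c @^-1` chart_dom c')
      (fun y => chart_map c' (chart_inv c y) 0 i).

Record manifold (R : realType) (n : nat) := Manifold {
  manifold_space :> topologicalType;
  manifold_hausdorff : hausdorff_space manifold_space;
  manifold_second_countable : @second_countable manifold_space;
  atlas : set (chart R n manifold_space);
  atlas_cover : forall x, exists2 c, atlas c & chart_dom c x;
  atlas_compatible : forall c c', atlas c -> atlas c' -> chart_compatible c c' }.

Section SmoothFunctions.
Variables (R : realType) (n : nat) (M : manifold R n).

Definition smooth (f : M -> R) : Prop :=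
  forall c, atlas c -> smooth_on (chart_img c) (f \o chart_inv c).

Definition smooth_pred : {pred M -> R^o} := [pred f | `[< smooth f >]].

(* The algebra C^oo(M). *)
Record smooth_fun := SmoothFun {
  smooth_fun_val :> M -> R^o;
  smooth_fun_subproof : smooth_fun_val \in smooth_pred }.

HB.instance Definition _ := [isSub for smooth_fun_val].
HB.instance Definition _ := [Choice of smooth_fun by <:].

Lemma smooth_funP (f : smooth_fun) : smooth f.
Proof. exact/asboolP/(smooth_fun_subproof f). Qed.

Definition mk_smooth (f : M -> R) (sf : smooth f) : smooth_fun :=
  SmoothFun (introT (asboolP _) sf : (f : M -> R^o) \in smooth_pred).

Fact smooth_cst (a : R) : smooth (cst a).
Proof. by move=> c _ k; exact: (@Ck_cst R n). Qed.

Fact smoothD (f g : M -> R) : smooth f -> smooth g -> smooth (f \+ g).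
Proof.
by move=> sf sg c ac k; apply: (CkD (@chart_img_open _ _ _ c) (sf c ac k) (sg c ac k)).
Qed.

Fact smoothM (f g : M -> R) : smooth f -> smooth g -> smooth (f \* g).
Proof.
by move=> sf sg c ac k; apply: (CkM (@chart_img_open _ _ _ c) (sf c ac k) (sg c ac k)).
Qed.

Fact smooth_subring_closed : subring_closed (smooth_pred : {pred M -> R}).
Proof.
split.
- exact/asboolP/smooth_cst.
- move=> f g /asboolP sf /asboolP sg; apply/asboolP.
  have -> : f - g = f \+ (cst (-1) \* g) by apply/funext => x /=; rewrite mulN1r.
  by apply: smoothD => //; apply: smoothM => //; exact: smooth_cst.
- by move=> f g /asboolP sf /asboolP sg; apply/asboolP/smoothM.
Qed.

HB.instance Definition _ :=
  GRing.SubChoice_isSubComPzRing.Build _ _ smooth_fun smooth_subring_closed.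

Definition smooth_const (a : R) : smooth_fun := mk_smooth (smooth_cst a).

Fact smooth_submod_closed : GRing.submod_closed smooth_pred.
Proof.
split; first exact/asboolP/smooth_cst.
move=> a f g /asboolP sf /asboolP sg; apply/asboolP.
apply: (@smoothD (cst a \* f) g) => //; apply: smoothM => //.
exact: smooth_cst.
Qed.

HB.instance Definition _ :=
  GRing.SubZmodule_isSubLmodule.Build _ _ _ smooth_fun
    (GRing.submod_closed_semi smooth_submod_closed).

End SmoothFunctions.

Section Tangent.
Variables (R : realType) (n : nat) (M : manifold R n).
Local Notation C := (smooth_fun M).

Section AtPoint.
Variable x : M.

Definition derivation_at (v : C -> R) : Prop :=
  scalar v /\ forall f g : C, v (f * g) = v f * g x + f x * v g.

Definition tangent_pred : {pred C -> R^o} := [pred v | `[< derivation_at v >]].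

(* T_xM, as the space of derivations at x of C^oo(M). *)
Record tangent := Tangent {
  tangent_val :> C -> R^o;
  tangent_subproof : tangent_val \in tangent_pred }.

HB.instance Definition _ := [isSub for tangent_val].
HB.instance Definition _ := [Choice of tangent by <:].

Lemma tangentP (v : tangent) : derivation_at v.
Proof. exact/asboolP/(tangent_subproof v). Qed.

Fact tangent_submod_closed : GRing.submod_closed tangent_pred.
Proof.
split.
  apply/asboolP; split=> [a f g|f g]; first by rewrite [RHS]addr0 mulr0.
  by rewrite mul0r mulr0 addr0.
move=> a u v /asboolP[ul uM] /asboolP[vl vM]; apply/asboolP.
split=> [b f g|f g]; rewrite !fctE.
  by rewrite ul vl; rewrite /GRing.scale/=; ring.
by rewrite uM vM /GRing.scale/=; ring.
Qed.

HB.instance Definition _ :=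
  GRing.SubChoice_isSubLmodule.Build _ _ _ tangent
    (GRing.submod_closed_semi tangent_submod_closed).

Definition cotangent_pred : {pred tangent -> R^o} := [pred w | `[< scalar w >]].

(* T*_xM, the dual of T_xM. *)
Record cotangent := Cotangent {
  cotangent_val :> tangent -> R^o;
  cotangent_subproof : cotangent_val \in cotangent_pred }.

HB.instance Definition _ := [isSub for cotangent_val].
HB.instance Definition _ := [Choice of cotangent by <:].

Lemma cotangentP (w : cotangent) : scalar w.
Proof. exact/asboolP/(cotangent_subproof w). Qed.

Fact cotangent_submod_closed : GRing.submod_closed cotangent_pred.
Proof.
split; first by apply/asboolP => a f g; rewrite [RHS]addr0 mulr0.
move=> a u v /asboolP ul /asboolP vl; apply/asboolP => b f g; rewrite !fctE.
by rewrite ul vl; rewrite /GRing.scale/=; ring.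
Qed.

HB.instance Definition _ :=
  GRing.SubChoice_isSubLmodule.Build _ _ _ cotangent
    (GRing.submod_closed_semi cotangent_submod_closed).

Fact diff_at_subproof (f : C) :
  ((fun v : tangent => v f) : tangent -> R^o) \in cotangent_pred.
Proof. by apply/asboolP. Qed.

Definition diff_at (f : C) : cotangent := Cotangent (diff_at_subproof f).

End AtPoint.

(* A section X of TM is smooth iff X(f) is smooth for every f in C^oo(M). *)
Definition smooth_vector_field (X : forall x : M, tangent x) : Prop :=
  forall f : C, smooth (fun x => X x f).

(* A section w of T*M is smooth iff w(X) is smooth for every smooth vector
   field X. *)
Definition smooth_covector_field (w : forall x : M, cotangent x) : Prop :=
  forall X, smooth_vector_field X -> smooth (fun x => w x (X x)).

(* Omega^1(M), a module over C^oo(M). *)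
Record form1 := Form1 {
  form1_val :> forall x : M, cotangent x;
  form1P : smooth_covector_field form1_val }.

HB.instance Definition _ := gen_eqMixin form1.
HB.instance Definition _ := gen_choiceMixin form1.

Lemma form1_eq (a b : form1) : (forall x, a x = b x) -> a = b.
Proof.
case: a b => [a sa] [b sb] /= ab.
have E : a = b by exact: functional_extensionality_dep.
by subst b; congr Form1; exact: Prop_irrelevance.
Qed.

Fact form1_zero_subproof : smooth_covector_field (fun x => 0).
Proof. by move=> X _; exact: (@smooth_cst R n M 0). Qed.
Definition form1_zero := Form1 form1_zero_subproof.

Fact form1_add_subproof (a b : form1) :
  smooth_covector_field (fun x => a x + b x).
Proof.
by move=> X sX; exact: (smoothD (@form1P a X sX) (@form1P b X sX)).
Qed.
Definition form1_add a b := Form1 (@form1_add_subproof a b).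

Fact form1_scale_subproof (f : C) (a : form1) :
  smooth_covector_field (fun x => f x *: a x).
Proof.
by move=> X sX; exact: (smoothM (smooth_funP f) (@form1P a X sX)).
Qed.
Definition form1_scale f a := Form1 (@form1_scale_subproof f a).

Definition form1_opp a := form1_scale (- 1) a.

Fact form1_addA : associative form1_add.
Proof. by move=> a b c; apply: form1_eq => x; exact: addrA. Qed.
Fact form1_addC : commutative form1_add.
Proof. by move=> a b; apply: form1_eq => x; exact: addrC. Qed.
Fact form1_add0 : left_id form1_zero form1_add.
Proof. by move=> a; apply: form1_eq => x; exact: add0r. Qed.
Fact form1_addN : left_inverse form1_zero form1_opp form1_add.
Proof.
by move=> a; apply: form1_eq => x /=; rewrite -[X in _ + X]scale1r -scalerDl addNr scale0r.
Qed.

HB.instance Definition _ :=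
  GRing.isZmodule.Build form1 form1_addA form1_addC form1_add0 form1_addN.

Fact form1_scaleA (f g : C) a :
  form1_scale f (form1_scale g a) = form1_scale (f * g) a.
Proof. by apply: form1_eq => x; exact: scalerA. Qed.
Fact form1_scale1 : left_id 1 form1_scale.
Proof. by move=> a; apply: form1_eq => x; exact: scale1r. Qed.
Fact form1_scaleDr : right_distributive form1_scale +%R.
Proof. by move=> f a b; apply: form1_eq => x; exact: scalerDr. Qed.
Fact form1_scaleDl a : {morph form1_scale^~ a : f g / f + g}.
Proof. by move=> f g; apply: form1_eq => x; exact: scalerDl. Qed.

HB.instance Definition _ :=
  GRing.Zmodule_isLmodule.Build C form1
    form1_scaleA form1_scale1 form1_scaleDr form1_scaleDl.

Fact diff_subproof (f : C) : smooth_covector_field (fun x => diff_at x f).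
Proof. by move=> X sX; exact: sX. Qed.

Definition diff (f : C) : form1 := Form1 (diff_subproof f).

(* A bivector field, as a smooth family of skew-symmetric bilinear forms on the
   cotangent spaces; linearity in the second argument follows from
   skew-symmetry. *)
Record bivector := Bivector {
  bivector_at :> forall x : M, cotangent x -> cotangent x -> R;
  bivector_linear : forall x (b : cotangent x),
    scalar (fun a => bivector_at a b);
  bivector_skew : forall x (a b : cotangent x),
    bivector_at a b = - bivector_at b a;
  bivector_smooth : forall a b : form1,
    smooth (fun x => bivector_at (a x) (b x)) }.

(* The function Pi(a, b) on M. *)
Definition bivector_app (Pi : bivector) (a b : form1) : C :=
  mk_smooth (bivector_smooth Pi a b).

Definition bracket (Pi : bivector) (f g : C) : C :=
  bivector_app Pi (diff f) (diff g).

Definition jacobi (Pi : bivector) : Prop :=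
  forall f g h : C,
    bracket Pi f (bracket Pi g h) + bracket Pi g (bracket Pi h f)
    + bracket Pi h (bracket Pi f g) = 0.

(* #a is the vector v with b(v) = Pi(a, b) for all covectors b at x; it exists
   and is unique because T_xM is finite-dimensional. *)
Definition sharp (Pi : bivector) (x : M) (a : cotangent x) : tangent x :=
  xget 0 [set v : tangent x | forall b : cotangent x, b v = Pi x a b].

(* A linear contravariant connection, given by its contravariant derivative. *)
Record contravariant_derivative (Pi : bivector) := ContravariantDerivative {
  cderiv :> form1 -> form1 -> form1;
  cderiv_linearl : forall (f1 f2 : C) (a1 a2 b : form1),
    cderiv (f1 *: a1 + f2 *: a2) b = f1 *: cderiv a1 b + f2 *: cderiv a2 b;
  cderivD : forall a b1 b2 : form1,
    cderiv a (b1 + b2) = cderiv a b1 + cderiv a b2;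
  cderivZ : forall (a : form1) (c : R) (b : form1),
    cderiv a (smooth_const M c *: b) = smooth_const M c *: cderiv a b;
  cderiv_leibniz : forall (a : form1) (f : C) (b : form1) (x : M),
    cderiv a (f *: b) x = f x *: cderiv a b x + sharp Pi (a x) f *: b x }.

(* (D_a L)(b, c) for a bivector field L. *)
Definition cderiv_bivector (Pi : bivector) (D : contravariant_derivative Pi)
    (a : form1) (L : bivector) (b c : form1) (x : M) : R :=
  sharp Pi (a x) (bivector_app L b c)
  - bivector_app L (D a b) c x - bivector_app L b (D a c) x.

End Tangent.

Record poisson_manifold (R : realType) (n : nat) := PoissonManifold {
  poisson_base :> manifold R n;
  poisson_bivector : bivector poisson_base;
  poisson_jacobi : jacobi poisson_bivector }.

(* Main.v *)
(* Call a finite family of functions f_i and vector fields X_i a frame where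
   v = \sum_i v(f_i) X_i for all tangent vectors v. In a frame, put
   D_a b = \sum_i a(X_i) L_(#df_i) b: this is C^oo-linear in a, it satisfies the
   Leibniz rule because #a = \sum_i a(X_i) #df_i, and it kills Pi because the
   Hamiltonian fields #df_i preserve Pi by the Jacobi identity. Frames exist
   around every point (cut off the coordinates and coordinate fields of a
   chart; that they span the derivations at a point is Hadamard's lemma), and
   the properties above survive gluing with a partition of unity. *)
From HB Require Import structures.
Require Import Defs.
From mathcomp Require Import all_boot all_order all_algebra.
From mathcomp Require Import all_classical all_reals all_analysis.
From mathcomp Require Import ring lra.

Set Implicit Arguments.
Unset Strict Implicit.
Unset Printing Implicit Defensive.

Import Order.TTheory GRing.Theory Num.Theory.
Import numFieldNormedType.Exports.

Local Open Scope classical_set_scope.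
Local Open Scope ring_scope.

(** * Differentiability of C^1 functions *)

(** The obvious candidate [L_(#a) b] obeys the Leibniz rule in [b], but it is not C^oo-linear in
    [a], and [#a] need not preserve Pi when [a] is not closed. Using Lie derivatives along [#df_i]
    only, for finitely many exact forms, and extending linearly in [a] repairs both defects. The
    frame is one of [TM], not one of Hamiltonian fields, so the rank of Pi may jump. Gluing works
    because each condition is affine in D: [#a(g) b] and [#a(Pi(b, c))] do not involve the
    connection, so an average with weights of sum 1 keeps them. Each local operator is defined on
    all of M and is only trusted where its weight is nonzero. Tangent vectors are derivations of the
    global algebra of functions. Hence local objects have to be cut off to global ones, and an
    identity of functions can be differentiated at a point only if it holds on a neighbourhood of
    it. Smoothness is given by iterated partial derivatives, so the chain rule and the smoothness of
    parameter integrals have to be derived from these. *)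

Section Line.
Variables (R : realType) (V : normedModType R).
Implicit Types (f : V -> R) (x v : V).

Lemma is_derive_line f x v (t : R) : derivable f (t *: v + x) v ->
  is_derive t 1 (fun s => f (s *: v + x)) ('D_v f (t *: v + x)).
Proof.
have E : (fun h : R => h^-1 *: (((fun s => f (s *: v + x)) \o shift t) h%:A
             - f (t *: v + x))) =
         (fun h : R => h^-1 *: ((f \o shift (t *: v + x)) (h *: v)
             - f (t *: v + x))).
  by apply/funext => h /=; rewrite [h%:A]mulr1 scalerDl addrA.
by move=> df; apply: DeriveDef; rewrite /derivable /derive E.
Qed.

(** The bound on [t] by absolute values makes one statement serve both signs of [r]; the mean value
    theorem is applied on [[0, r]] or on [[r, 0]]. *)
Lemma MVT_line f x v (r : R) :
  (forall t : R, `|t| <= `|r| -> derivable f (t *: v + x) v) ->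
  exists2 t : R, `|t| <= `|r| & f (r *: v + x) - f x = r * 'D_v f (t *: v + x).
Proof.
move=> df; pose g (s : R) := f (s *: v + x).
have dg (t : R) : `|t| <= `|r| -> is_derive t 1 g ('D_v f (t *: v + x)).
  by move=> tr; apply: is_derive_line; exact: df.
have cg (a b : R) : (forall t : R, a <= t <= b -> `|t| <= `|r|) ->
    {within `[a, b], continuous g}.
  move=> ab; apply: derivable_within_continuous => t; rewrite in_itv /= => tab.
  by have [] := dg t (ab t tab).
have g0 : g 0 = f x by rewrite /g scale0r add0r.
have [r0|r0] := leP 0 r.
  have H (t : R) : 0 <= t <= r -> `|t| <= `|r|.
    by move=> /andP[t0 tr]; rewrite !ger0_norm.
  have [|t] := @MVT_segment R g (fun t => 'D_v f (t *: v + x)) _ _ r0 _ (cg _ _ H).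
    by move=> t; rewrite in_itv /= => /andP[/ltW t0 /ltW tr]; apply/dg/H; rewrite t0.
  rewrite in_itv /= => tr; rewrite g0 subr0 mulrC => ->.
  by exists t => //; exact: H.
have H (t : R) : r <= t <= 0 -> `|t| <= `|r|.
  by move=> /andP[t0 tr]; rewrite !ler0_norm ?lerN2// ltW.
have [|t] := @MVT_segment R g (fun t => 'D_v f (t *: v + x)) _ _ (ltW r0) _ (cg _ _ H).
  by move=> t; rewrite in_itv /= => /andP[/ltW t0 /ltW tr]; apply/dg/H; rewrite t0.
rewrite in_itv /= => tr; rewrite g0 sub0r => E.
exists t; first exact: H.
by rewrite -opprB E; ring.
Qed.

End Line.

Section Differentiable.
Variables (R : realType) (n : nat).
Implicit Types (U : set 'rV[R]_n) (f : 'rV[R]_n -> R) (x h v : 'rV[R]_n).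
Local Notation e i := (delta_mx 0 i : 'rV[R]_n).

Definition trunc_row (k : nat) h : 'rV[R]_n := \row_j (if (j < k)%N then h 0 j else 0).

Lemma trunc_row0 h : trunc_row 0 h = 0.
Proof. by apply/rowP => j; rewrite !mxE. Qed.

Lemma trunc_row_full h : trunc_row n h = h.
Proof. by apply/rowP => j; rewrite !mxE ltn_ord. Qed.

Lemma trunc_rowS (i : 'I_n) h : trunc_row i.+1 h = h 0 i *: e i + trunc_row i h.
Proof.
apply/rowP => j; rewrite !mxE eqxx /= ltnS (leq_eqVlt j i).
have [->|ne] := eqVneq j i; first by rewrite ltnn eqxx mulr1 addr0.
by rewrite (_ : (j == i :> nat) = false) ?mulr0 ?add0r//; apply/negbTE.
Qed.

Lemma coord_le_norm h i : `|h 0 i| <= `|h|.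
Proof.
have -> : `|h| = mx_norm h by [].
by rewrite mx_normrE; apply: (le_bigmax _ (fun ij : 'I_1 * 'I_n => `|h ij.1 ij.2|) (0, i)).
Qed.

Lemma ball_rowE x y (r : R) : ball x r y = (`|x - y| < r) :> Prop.
Proof. by rewrite -ball_normE. Qed.

Lemma le_row_norm h (r : R) : 0 <= r -> (forall i, `|h 0 i| <= r) -> `|h| <= r.
Proof.
move=> r0 hr; have -> : `|h| = mx_norm h by [].
by rewrite mx_normrE; apply: bigmax_le => // -[i j] _; rewrite ord1.
Qed.

End Differentiable.

Lemma continuous_sumr (R : realType) (T : topologicalType) (I : Type)
    (r : seq I) (P : pred I) (F : I -> T -> R) :
  (forall i, P i -> continuous (F i)) ->
  continuous (fun x => \sum_(i <- r | P i) F i x).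
Proof.
exact: (@continuous_big R^o I +%R 0 P (@add_continuous R^o) T r F).
Qed.

Section C1.
Variables (R : realType) (n : nat).
Implicit Types (U : set 'rV[R]_n) (f : 'rV[R]_n -> R) (x h v : 'rV[R]_n).
Local Notation e i := (delta_mx 0 i : 'rV[R]_n).

(* Change the coordinates one at a time and apply the mean value theorem to each
   step. *)
Lemma C1_differentiable U f x : open U -> Ck 1 U f -> U x ->
  differentiable f x /\ forall v, 'd f x v = \sum_i v 0 i * 'D_(e i) f x.
Proof.
move=> oU [fc fk] Ux.
pose L v : R := \sum_i v 0 i * 'D_(e i) f x.
have Llin : linear (L : 'rV[R]_n -> R^o).
  move=> a u v; rewrite /L scaler_sumr -big_split /=; apply: eq_bigr => i _.
  by rewrite !mxE mulrDl /GRing.scale/= mulrA.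
pose LM := GRing.isLinear.Build _ _ _ _ _ Llin.
pose LL : {linear 'rV[R]_n -> R^o} := HB.pack (L : 'rV[R]_n -> R^o) LM.
have Lcont : continuous LL.
  change (continuous (L : _ -> R^o)); rewrite /L.
  apply: continuous_sumr => i _ v.
  have cv : {for v, continuous (fun w : 'rV[R]_n => w 0 i : R^o)} by exact: coord_continuous.
  by apply: (cvgM cv); exact: cvg_cst.
have xU : x \in U by rewrite inE.
have Lo : (f : 'rV[R]_n -> R^o) \o shift x = cst (f x : R^o) + LL +o_ (0 : 'rV[R]_n) id.
  apply/eqaddoP => _/posnumP[eps].
  (* Each of the [n] coordinate steps contributes an error of at most [eps' * |h|]; dividing by
     [n.+1] also covers [n = 0]. *)
  pose eps' := eps%:num / n.+1%:R.
  have eps'0 : 0 < eps' by rewrite divr_gt0.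
  have : nbhs x (U `&` [set y | forall i, `|'D_(e i) f y - 'D_(e i) f x| <= eps']).
    apply: filterI; first exact: open_nbhs_nbhs.
    apply: (@filter_forall _ 'I_n (fun i => [set y |
      `|'D_(e i) f y - 'D_(e i) f x| <= eps']) (nbhs x) _) => i.
    have [_ []] := fk i => /(_ _ xU) + _.
    by move=> /cvgrPdist_le /(_ _ eps'0); apply: filterS => y; rewrite distrC.
  move=> /nbhs_ballP[d /= d0 Hd].
  apply/nbhs_ballP; exists d => //= h; rewrite ball_rowE sub0r normrN => hd.
  have {}Hd y : `|y| <= `|h| ->
      U (y + x) /\ forall i, `|'D_(e i) f (y + x) - 'D_(e i) f x| <= eps'.
    move=> yh; apply: Hd; rewrite ball_rowE distrC addrK.
    exact: le_lt_trans hd.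
  rewrite !fctE /= -/(L h) /=.
  pose z k := trunc_row k h + x.
  have step (i : 'I_n) : `|f (z i.+1) - f (z i) - h 0 i * 'D_(e i) f x| <= eps' * `|h|.
    (* The norm is the maximum of the coordinates, so replacing [h 0 i] by a smaller [t] and later
       coordinates by 0 does not leave the ball of radius [|h|]. *)
    have zP (t : R) : `|t| <= `|h 0 i| -> `|t *: e i + trunc_row i h| <= `|h|.
      move=> th; apply: le_row_norm => // j; rewrite !mxE eqxx /=.
      have [->|ne] := eqVneq j i.
        by rewrite ltnn mulr1 addr0; apply: le_trans th _; exact: coord_le_norm.
      rewrite mulr0 add0r; case: ifP => _; last by rewrite normr0.
      exact: coord_le_norm.
    have [|t th E] := @MVT_line R _ f (z i) (e i) (h 0 i).
      move=> t /zP /Hd[Uz _]; have [+ _] := fk i; rewrite /z addrA.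
      by apply; rewrite inE.
    rewrite [z i.+1]/z trunc_rowS -[_ + _ + x]addrA -/(z i) E -mulrBr normrM mulrC.
    apply: ler_pM => //; last exact: coord_le_norm.
    by rewrite /z addrA; have [_] := Hd _ (zP _ th); exact.
  have -> : f (h + x) - (f x + L h) =
      \sum_(i < n) (f (z i.+1) - f (z i) - h 0 i * 'D_(e i) f x).
    rewrite big_split /= sumrN opprD addrA; congr (_ - _).
    rewrite -(big_mkord xpredT (fun i => f (z i.+1) - f (z i))) telescope_sumr//.
    by rewrite /z trunc_row0 trunc_row_full add0r.
  apply: le_trans (ler_norm_sum _ _ _) _.
  apply: le_trans (ler_sum _ (fun i _ => step i)) _.
  rewrite sumr_const card_ord -mulr_natr /eps'.
  rewrite mulrAC ler_wpM2r//.
  by rewrite -mulrA ler_piMr// mulrC ler_pdivrMr// mul1r ler_nat.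
have dE : 'd f x = LL :> (_ -> _) by exact: diff_unique.
split; last by move=> v; rewrite dE.
by apply/diff_locallyP; rewrite dE.
Qed.

Lemma Ck_differentiable k U f x : open U -> Ck k.+1 U f -> U x -> differentiable f x.
Proof.
move=> oU Cf Ux; apply: (C1_differentiable oU _ Ux).1.
by elim: k Cf => // k IH /CkW.
Qed.

End C1.

(** * Operations on C^k functions *)

Lemma cvg_sumr (R : realType) (V : normedModType R) (T : Type)
    (F : set_system T) (I : Type) (r : seq I) (P : pred I) (f : I -> T -> V) (a : I -> V) :
  Filter F -> (forall i, P i -> f i x @[x --> F] --> a i) ->
  \sum_(i <- r | P i) f i x @[x --> F] --> \sum_(i <- r | P i) a i.
Proof. exact: (@cvg_big V I +%R 0 P (@add_continuous V)). Qed.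

Section Row.
Variables (R : realType) (T : topologicalType) (n : nat).

Lemma continuous_row (g : T -> 'rV[R]_n) (x : T) :
  (forall j, {for x, continuous (fun y => g y 0 j)}) -> {for x, continuous g}.
Proof.
move=> cg; have -> : g = fun y => \sum_j g y 0 j *: delta_mx 0 j.
  by apply/funext => y; rewrite [LHS]row_sum_delta.
apply: cvg_sumr => j _; apply: cvgZr_tmp; exact: cg.
Qed.

End Row.

Lemma differentiable_row (R : realType) (V : normedModType R) (n : nat)
    (g : V -> 'rV[R]_n) (x : V) :
  (forall j, differentiable (fun y => g y 0 j : R) x) -> differentiable g x.
Proof.
move=> dg; have -> : g = \sum_(j < n) (fun y => g y 0 j *: delta_mx 0 j).
  by apply/funext => y; rewrite fct_sumE [LHS]row_sum_delta.
apply: differentiable_sum => j; exact: differentiableZl.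
Qed.

Section CkComp.
Variables (R : realType).

Lemma Ck_subset n k (U V : set 'rV[R]_n) (f : 'rV[R]_n -> R) :
  V `<=` U -> Ck k U f -> Ck k V f.
Proof.
move=> VU.
have VU' (P : 'rV[R]_n -> Prop) : {in U, forall x, P x} -> {in V, forall x, P x}.
  by move=> H x; rewrite inE => /VU xU; apply: H; rewrite inE.
elim: k f => [|k IH] f [fc fk]; split => //; try exact: VU'.
by move=> i; have [fd /IH fk'] := fk i; split => //; exact: VU'.
Qed.

Lemma Ck_local n k (U : set 'rV[R]_n) (f : 'rV[R]_n -> R) :
  (forall x, U x -> exists2 V, V x & Ck k V f) -> Ck k U f.
Proof.
elim: k f => [|k IH] f Uf.
  split=> // x; rewrite inE => /Uf[V Vx [Vf _]]; apply: Vf; exact/mem_set.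
split=> [x|i]; first by rewrite inE => /Uf[V Vx [Vf _]]; apply: Vf; exact/mem_set.
split=> [x|]; first by rewrite inE => /Uf[V Vx [_ /(_ i)[Vf _]]]; apply: Vf; exact/mem_set.
by apply: IH => x /Uf[V Vx [_ /(_ i)[_ Vf]]]; exists V.
Qed.

Lemma Ck_sum n k (U : set 'rV[R]_n) (I : Type) (r : seq I) (f : I -> 'rV[R]_n -> R) :
  open U -> (forall i, Ck k U (f i)) -> Ck k U (fun x => \sum_(i <- r) f i x).
Proof.
move=> oU Uf; elim: r => [|i r IH].
  by under eq_fun do rewrite big_nil; exact: (@Ck_cst R n).
by under eq_fun do rewrite big_cons; apply: (CkD oU (Uf i) IH).
Qed.

Lemma Ck_prod n k (U : set 'rV[R]_n) (I : Type) (r : seq I) (f : I -> 'rV[R]_n -> R) :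
  open U -> (forall i, Ck k U (f i)) -> Ck k U (fun x => \prod_(i <- r) f i x).
Proof.
move=> oU Uf; elim: r => [|i r IH].
  by under eq_fun do rewrite big_nil; exact: (@Ck_cst R n).
by under eq_fun do rewrite big_cons; apply: (CkM oU (Uf i) IH).
Qed.

Lemma is_derive_coord n (x v : 'rV[R]_n) (i : 'I_n) :
  is_derive x v (fun y : 'rV[R]_n => y 0 i : R) (v 0 i).
Proof.
apply: DeriveDef; first by apply: diff_derivable; exact: differentiable_coord.
have := @derive_mx R _ _ _ id x v; rewrite derive_id => /(_ (@derivable_id _ _ _ _)).
by move=> /rowP/(_ i); rewrite mxE => ->.
Qed.

Lemma Ck_coord n k (U : set 'rV[R]_n) (i : 'I_n) :
  Ck k U (fun x => x 0 i).
Proof.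
case: k => [|k]; split => //.
- move=> x _; exact: coord_continuous.
- move=> x _; exact: coord_continuous.
move=> j; split; first by move=> x _; have [] := is_derive_coord x (delta_mx 0 j) i.
under eq_fun => x do rewrite (@derive_val _ _ _ _ _ _ _ (is_derive_coord x (delta_mx 0 j) i)).
exact: Ck_cst.
Qed.

(** Induction on [k] with [g] fixed and [f] varying: by the chain rule, a partial derivative of the
    composite is a sum of products of a partial derivative of [g_j] with the composite of [g] and
    the j-th partial derivative of [f], to which the induction hypothesis applies. *)
Lemma Ck_comp m n k (U : set 'rV[R]_m) (V : set 'rV[R]_n) (f : 'rV[R]_n -> R)
    (g : 'rV[R]_m -> 'rV[R]_n) :
  open U -> open V -> (forall j, Ck k U (fun x => g x 0 j)) ->
  (forall x, U x -> V (g x)) -> Ck k V f -> Ck k U (f \o g).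
Proof.
move=> oU oV; elim: k f => [|k IH] f Ug UV Vf.
all: have gc (x : 'rV[R]_m) : x \in U -> {for x, continuous g} by
  move=> xU; apply: continuous_row => j; exact: (Ck_continuous (Ug j)) xU.
all: have fgc : {in U, continuous (f \o g)} by
  move=> x xU; apply: continuous_comp; [exact: gc|
   apply: (Ck_continuous Vf); apply/mem_set/UV/set_mem].
  by split.
split => // i.
have dg (x : 'rV[R]_m) : x \in U -> differentiable g x.
  move=> /set_mem xU; apply: differentiable_row => j.
  exact: Ck_differentiable (Ug j) xU.
have df (x : 'rV[R]_m) : x \in U -> differentiable f (g x).
  by move=> /set_mem xU; exact: (Ck_differentiable oV Vf (UV _ xU)).
have dfg (x : 'rV[R]_m) : x \in U -> differentiable (f \o g) x.
  by move=> xU; apply: differentiable_comp; [exact: dg|exact: df].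
split; first by move=> x xU; apply: diff_derivable; exact: dfg.
apply: (@Ck_ext _ _ _ _ (fun x => \sum_j
    'D_(delta_mx 0 i) (fun y => g y 0 j) x * 'D_(delta_mx 0 j) f (g x))) => //.
  move=> x xU; rewrite deriveE; last exact: dfg.
  rewrite (diff_comp (dg _ xU) (df _ xU)) /=.
  have C1 : Ck 1 V f by elim: (k) Vf => // k' IHk /CkW.
  rewrite (C1_differentiable oV C1 (UV _ (set_mem xU))).2.
  apply: eq_bigr => j _; congr (_ * _).
  rewrite -deriveE; last exact: dg.
  by rewrite derive_mx ?mxE //; apply: diff_derivable; exact: dg.
apply: (@Ck_sum m k U _ _ (fun j x => 'D_(delta_mx 0 i) (fun y => g y 0 j) x *
  'D_(delta_mx 0 j) f (g x))) => // j; apply: CkM => //.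
  by have [_ /(_ i)[]] := Ug j.
apply: (IH (fun y => 'D_(delta_mx 0 j) f y)) => //; first by move=> j'; exact: CkW.
by have [_ /(_ j)[]] := Vf.
Qed.

End CkComp.

(** * Cutoff functions *)

Lemma is_derive_comp1 (R : realType) (V : normedModType R) (f : R -> R) (g : V -> R) x v (df : R) :
  differentiable g x -> is_derive (g x) 1 f df ->
  is_derive x v (f \o g) ('D_v g x * df).
Proof.
move=> dg [fd <-].
have fd' : differentiable f (g x) by apply/derivable1_diffP.
have dfg : differentiable (f \o g) x by exact: differentiable_comp.
apply: DeriveDef; first exact: diff_derivable.
by rewrite deriveE// diff_comp//= diff1E// derive1E -deriveE.
Qed.

Section Flat.
Variable R : realType.

(* [flat 0] is the standard function flat at 0; the family is closed under
   derivation up to linear combinations. *)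
Definition flat (m : nat) (t : R) : R := if 0 < t then t^-1 ^+ m * expR (- t^-1) else 0.

Lemma flat_ge0 m t : 0 <= flat m t.
Proof.
by rewrite /flat; case: ifP => // t0; rewrite mulr_ge0 ?expR_ge0// exprn_ge0// invr_ge0 ltW.
Qed.

Lemma flat_gt0 m t : 0 < t -> 0 < flat m t.
Proof. by rewrite /flat => t0; rewrite t0 mulr_gt0 ?expR_gt0// exprn_gt0// invr_gt0. Qed.

Lemma flat_le0 m t : t <= 0 -> flat m t = 0.
Proof. by rewrite /flat ltNge => ->. Qed.

(** With [u = t^-1], this is the exponential bound [u^(m+1) / (m+1)! <= exp u]. It controls the
    difference quotients at 0. *)
Lemma flat_le m t : flat m t <= m.+1`!%:R * `|t|.
Proof.
have [t0|t0] := ltP 0 t; last by rewrite flat_le0// mulr_ge0.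
rewrite /flat t0 gtr0_norm//.
have u0 : 0 < t^-1 by rewrite invr_gt0.
have := expR_ge1Dxn m (ltW u0) => H.
have {}H : t^-1 ^+ m.+1 / m.+1`!%:R <= expR t^-1 by apply: le_trans H; rewrite lerDr.
rewrite expRN ler_pdivrMr ?expR_gt0//.
rewrite ler_pdivrMr ?ltr0n ?fact_gt0// in H.
rewrite -(ler_pM2l u0) -exprS (le_trans H)//.
by rewrite mulrA mulrCA mulVf ?gt_eqF// mulr1 mulrC.
Qed.

(** For [t > 0], differentiate [u^m exp(-u)] at [u = t^-1]; for [t < 0] the function is locally 0.
    At 0 the difference quotient of [flat m] is [flat m.+1], which tends to 0 by [flat_le]. *)
Lemma is_derive_flat (m : nat) (t : R) :
  is_derive t 1 (flat m) (flat m.+2 t - m%:R * flat m.+1 t).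
Proof.
have [t0|t0|<-] := ltgtP 0 t.
- pose phi (u : R) := u ^+ m * expR (- u).
  have dphi (u : R) : is_derive u 1 phi (m%:R * u ^+ m.-1 * expR (- u) - u ^+ m * expR (- u)).
    have H1 : is_derive u 1 (fun w : R => expR (- w)) (- expR (- u)).
      apply: (@is_derive_eq _ _ _ _ _ _ _ _
        (@is_derive_comp1 R R (@expR R) (-%R) u 1 _ _ (is_derive_expR _))).
        by apply: differentiableN.
      by rewrite deriveN ?derive_id ?mulN1r.
    have H2 : is_derive u 1 (fun w : R => w ^+ m) (m%:R * u ^+ m.-1).
      have := @is_deriveX R R id m u 1 1 (is_derive_id _ _).
      by rewrite exprfctE /GRing.scale/= mulr1.
    apply: is_derive_eq (is_deriveM H2 H1) _.
    by rewrite /GRing.scale/=; ring.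
  have dinv : is_derive t 1 (fun s : R => s^-1) (- t ^- 2).
    apply: DeriveDef; first by apply: (@derivableV R R id); rewrite ?gt_eqF.
    rewrite (@deriveV R R id) ?gt_eqF//.
    by rewrite derive_id /GRing.scale/= mulr1.
  have tt : t != 0 by rewrite gt_eqF.
  apply: (@near_eq_is_derive _ _ _ (phi \o (fun s : R => s^-1))).
    near=> s; rewrite /flat /phi /= ifT//.
    by near: s; exact: lt_nbhsr.
  have [dd de] := dinv.
  apply: is_derive_eq (is_derive_comp1 _ _ (dphi _)) _.
    by apply/derivable1_diffP.
  rewrite de /flat t0; case: (m) => [|p] /=; rewrite ?exprS; field => //.
- rewrite !flat_le0 ?ltW// mulr0 subr0.
  apply: (@near_eq_is_derive _ _ _ (cst 0)).
  near=> s; rewrite flat_le0//= ltW//.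
  by near: s; exact: lt_nbhsl.
- rewrite !flat_le0// mulr0 subr0.
  have C : h^-1 *: ((flat m \o shift 0) h%:A - flat m 0) @[h --> (0:R)^'] --> (0:R).
    apply/cvgrPdist_le => eps eps0; near=> h.
    rewrite /= addr0 [h%:A]mulr1 (@flat_le0 m 0)// subr0 sub0r normrN.
    have -> : h^-1 *: flat m h = flat m.+1 h.
      rewrite /flat; case: ifP => _; last by rewrite scaler0.
      by rewrite /GRing.scale/= mulrA -exprS.
    rewrite ger0_norm ?flat_ge0// (le_trans (flat_le _ _))//.
    rewrite -ler_pdivlMl ?ltr0n ?fact_gt0//.
    near: h; apply: dnbhs0_le.
    by rewrite mulr_gt0// invr_gt0 ltr0n fact_gt0.
  apply: DeriveDef; first by apply/cvg_ex; exists 0.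
  exact: cvg_lim C.
Unshelve. all: by end_near. Qed.

Variable n : nat.
Implicit Types (U : set 'rV[R]_n) (g : 'rV[R]_n -> R).

(** The induction must let [m] vary, because one derivation turns [flat m] into [flat m.+1] and
    [flat m.+2]. *)
Lemma Ck_flat k U g m : open U -> Ck k U g -> Ck k U (flat m \o g).
Proof.
move=> oU; elim: k m g => [|k IH] m g Ug.
all: have c : {in U, continuous (flat m \o g)} by
  move=> x xU; apply: continuous_comp; [exact: (Ck_continuous Ug)|
    apply: differentiable_continuous; apply/derivable1_diffP;
    have [] := is_derive_flat m (g x)].
  by split.
have dg x : x \in U -> differentiable g x.
  by move=> /set_mem xU; exact: Ck_differentiable Ug xU.
have d (i : 'I_n) (x : 'rV[R]_n) (xU : x \in U) :=
  is_derive_comp1 (delta_mx 0 i) (dg x xU) (is_derive_flat m (g x)).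
split=> // i; split; first by move=> x xU; have [] := d i x xU.
apply: (@Ck_ext _ _ _ _ ('D_(delta_mx 0 i) g \*
  (flat m.+2 \o g \+ (cst (- m%:R) \* (flat m.+1 \o g))))) => //.
  by move=> x xU; have [_ ->] := d i x xU; rewrite /= mulNr.
apply: CkM => //; first by have [_ /(_ i)[]] := Ug.
apply: CkD => //; first exact/IH/CkW.
apply: CkM => //; first exact: Ck_cst.
exact/IH/CkW.
Qed.

Lemma Ck_inv k U g : open U -> (forall x, U x -> g x != 0) -> Ck k U g ->
  Ck k U (fun x => (g x)^-1).
Proof.
move=> oU g0; elim: k => [|k IH] Ug.
all: have c : {in U, continuous (fun x => (g x)^-1)} by
  move=> x xU; exact: (cvgV (g0 _ (set_mem xU)) (Ck_continuous Ug xU)).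
  by split.
have d (i : 'I_n) (x : 'rV[R]_n) : x \in U -> derivable g x (delta_mx 0 i).
  by have [_ /(_ i)[+ _]] := Ug; apply.
split=> // i; split.
  by move=> x xU; apply: derivableV; [exact/g0/set_mem|exact: d].
apply: (@Ck_ext _ _ _ _ (cst (-1) \* ('D_(delta_mx 0 i) g \*
  ((fun x => (g x)^-1) \* (fun x => (g x)^-1))))) => //.
  move=> x xU; rewrite deriveV//; [|exact/g0/set_mem|exact: d].
  by rewrite /= expr2 invfM /GRing.scale /=; ring.
apply: CkM => //; first exact: Ck_cst.
apply: CkM => //; first by have [_ /(_ i)[]] := Ug.
by apply: CkM => //; exact/IH/CkW.
Qed.

(** The standard smooth step from 0 to 1; the denominator is positive because [t] and [1 - t] are
    never both nonpositive. *)
Definition plateau (t : R) : R := flat 0 t / (flat 0 t + flat 0 (1 - t)).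

Lemma plateau_denom_gt0 t : 0 < flat 0 t + flat 0 (1 - t).
Proof.
have [t0|t0] := ltP 0 t; first by rewrite ltr_wpDr ?flat_ge0 ?flat_gt0.
by rewrite ltr_wpDl ?flat_ge0// flat_gt0// subr_gt0 (le_lt_trans t0).
Qed.

Lemma plateau1 t : 1 <= t -> plateau t = 1.
Proof.
move=> t1; rewrite /plateau (@flat_le0 0 (1 - t)) ?subr_le0// addr0 divff//.
by rewrite gt_eqF// flat_gt0// (lt_le_trans _ t1).
Qed.

Lemma plateau0 t : t <= 0 -> plateau t = 0.
Proof. by move=> t0; rewrite /plateau flat_le0// mul0r. Qed.

Lemma Ck_plateau k U g : open U -> Ck k U g -> Ck k U (plateau \o g).
Proof.
move=> oU Ug; rewrite /plateau.
have Ug1 : Ck k U (fun x => 1 - g x).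
  apply: (@Ck_ext _ _ _ _ (cst 1 \+ (cst (-1) \* g))) => //.
    by move=> x _ /=; rewrite mulN1r.
  by apply: CkD => //; [exact: Ck_cst|apply: CkM => //; exact: Ck_cst].
apply: (CkM oU); first exact: (Ck_flat 0).
apply: Ck_inv => //; first by move=> x _; rewrite gt_eqF// plateau_denom_gt0.
apply: (CkD oU); first exact: (Ck_flat 0).
exact: (Ck_flat 0 oU Ug1).
Qed.

Lemma cutoff_exists (q : 'rV[R]_n) (r : R) : 0 < r ->
  exists chi : 'rV[R]_n -> R, [/\ forall U, open U -> smooth_on U chi,
    forall y, `|y - q| <= r -> chi y = 1 &
    forall y, 2 * r <= `|y - q| -> chi y = 0].
Proof.
move=> r0.
(* The square replaces the absolute value, which is not smooth. The argument of [plateau] is at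
   least 1 when the i-th coordinate of [y - q] is at most [r] in absolute value, and at most -2 when
   it is at least [2 * r]. *)
exists (fun y => \prod_i plateau (2 - ((y 0 i - q 0 i) / r) ^+ 2)); split.
- move=> U oU k; apply: (Ck_prod _ oU) => i.
  apply: (Ck_plateau oU).
  pose a : 'rV[R]_n -> R := fun y => y 0 i.
  have Ca : Ck k U a by exact: Ck_coord.
  pose b : 'rV[R]_n -> R := (a \+ cst (- q 0 i)) \* cst r^-1.
  have Cb : Ck k U b.
    by apply: CkM => //; [apply: CkD => //|]; exact: Ck_cst.
  apply: (@Ck_ext _ _ _ _ (cst 2 \+ (cst (-1) \* (b \* b)))) => //.
    by move=> y _; rewrite /b /a /=; ring.
  apply: CkD => //; first exact: Ck_cst.
  apply: CkM => //; first exact: Ck_cst.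
  exact: CkM.
- move=> y yr; apply: big1 => i _; apply: plateau1.
  rewrite lerBrDl -lerBrDr (_ : 2 - 1 = 1); last by ring.
  rewrite -real_normK ?num_real// expr_le1 ?normr_ge0// normrM normfV (gtr0_norm r0).
  rewrite ler_pdivrMr// mul1r; apply: le_trans yr.
  by have := coord_le_norm (y - q) i; rewrite !mxE.
- move=> y yr.
  (* A nonzero maximum norm is attained at some coordinate, and the factor of that coordinate
     vanishes. *)
  have ne0 : mx_norm (y - q) != 0.
    have -> : mx_norm (y - q) = `|y - q| by [].
    by rewrite gt_eqF// (lt_le_trans _ yr)// mulr_gt0.
  have [[i0 i] /= E] := mx_norm_neq0 ne0.
  rewrite (bigD1 i)//= plateau0 ?mul0r//.
  rewrite subr_le0 -real_normK ?num_real//.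
  apply: (@le_trans _ _ (2 ^+ 2)); first by rewrite expr2; lra.
  rewrite lerXn2r ?nnegrE// normrM normfV (gtr0_norm r0) ler_pdivlMr//.
  have Eq : `|y - q| = `|(y - q) i0 i| by rewrite -E.
  by rewrite Eq ord1 !mxE in yr.
Qed.

End Flat.

(** * Hadamard's lemma *)

Section Int01.
Variable R : realType.
Implicit Types f g : R -> R.

Definition int01 f : R := \int[lebesgue_measure]_(t in `[0 : R, 1]) f t.

Lemma integrable01 f : continuous f ->
  (@lebesgue_measure R).-integrable `[0 : R, 1] (EFin \o f).
Proof.
move=> cf; apply: continuous_compact_integrable; first exact: segment_compact.
exact: continuous_subspaceT.
Qed.

Lemma int01D f g : continuous f -> continuous g ->
  int01 (fun t => f t + g t) = int01 f + int01 g.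
Proof. by move=> cf cg; apply: RintegralD => //; exact: integrable01. Qed.

Lemma int01B f g : continuous f -> continuous g ->
  int01 (fun t => f t - g t) = int01 f - int01 g.
Proof. by move=> cf cg; apply: RintegralB => //; exact: integrable01. Qed.

Lemma int01Z a f : continuous f -> int01 (fun t => a * f t) = a * int01 f.
Proof. by move=> cf; apply: RintegralZl => //; exact: integrable01. Qed.

Lemma int01_cst a : int01 (fun=> a) = a.
Proof.
rewrite /int01 Rintegral_cst// [X in fine X](_ : _ = 1%E) ?mulr1//.
by have := @lebesgue_measure_itv R `[0, 1] => /= ->; rewrite lte_fin ltr01 oppr0 adde0.
Qed.

Lemma eq_int01 f g : (forall t, 0 <= t <= 1 -> f t = g t) -> int01 f = int01 g.
Proof. by move=> fg; apply: eq_Rintegral => t; rewrite inE /= in_itv /= => /fg. Qed.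

Lemma int01_sum (I : Type) (r : seq I) (f : I -> R -> R) :
  (forall i, continuous (f i)) ->
  int01 (fun t => \sum_(i <- r) f i t) = \sum_(i <- r) int01 (f i).
Proof.
move=> cf; elim: r => [|i r IH].
  by under eq_int01 do rewrite big_nil; rewrite int01_cst big_nil.
under eq_int01 do rewrite big_cons.
by rewrite int01D ?IH ?big_cons//; apply: continuous_sumr => j _.
Qed.

Lemma int01_bound f (c : R) : continuous f -> (forall t, 0 <= t <= 1 -> `|f t| <= c) ->
  `|int01 f| <= c.
Proof.
move=> cf fc; rewrite -[leRHS](int01_cst c).
apply: le_trans (le_normr_Rintegral _ (integrable01 cf)) _ => //.
apply: le_Rintegral => //.
- by apply: (@integrable01 (fun t => `|f t|)) => t; apply: cvg_norm; exact: cf.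
- by apply: (@integrable01 (fun=> c)) => t; exact: cvg_cst.
Qed.

Lemma int01_derive f df : (forall t : R, is_derive t 1 f (df t)) -> continuous df ->
  int01 df = f 1 - f 0.
Proof.
move=> fdf cdf; rewrite /int01 /Rintegral (@continuous_FTC2 _ df f)//.
- exact: continuous_subspaceT.
- have cf : continuous f.
    move=> t; apply: differentiable_continuous; apply/derivable1_diffP.
    by have [] := fdf t.
  split; first by move=> t _; have [] := fdf t.
    by apply: cvg_at_right_filter; exact: cf.
  by apply: cvg_at_left_filter; exact: cf.
- by move=> t _; rewrite derive1E; have [_ ->] := fdf t.
Qed.

End Int01.

(** * Continuity and differentiation under the integral sign *)

Section Parametric.
Variables (R : realType) (V : normedModType R).

(** A tube lemma: compactness of [[0, 1]] turns joint continuity into an estimate near [y] that is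
    uniform in [t]. *)
Lemma param_unif (K : R -> V -> R) (y : V) (e : R) :
  continuous (fun p : R * V => K p.1 p.2) -> 0 < e ->
  \forall z \near y, forall t, 0 <= t <= 1 -> `|K t z - K t y| <= e.
Proof.
move=> cK e0.
have H := iffLR (compact_near_coveringP `[0 : R, 1]) (@segment_compact R 0 1) V (nbhs y)
  (fun z t => `|K t z - K t y| <= e) (nbhs_filter y).
apply: filterS (H _) => [z Hz t t01|t _]; first by apply: Hz; rewrite /= in_itv.
have e2 : 0 < e / 2 by rewrite divr_gt0.
have := cK (t, y) => /cvgrPdist_le /(_ _ e2) [[A B] /= [tA yB] AB].
exists (A, B) => // -[s z] /= [sA zB].
rewrite -(subrKA (K t y)) (le_trans (ler_normD _ _))// (splitr e) lerD//.
  by rewrite distrC; apply: (AB (s, z)).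
by apply: (AB (s, y)); split => //; exact: nbhs_singleton.
Qed.

Lemma continuous_slice (K : R -> V -> R) (y : V) :
  continuous (fun p : R * V => K p.1 p.2) -> continuous (K^~ y).
Proof.
move=> cK t; apply: (@continuous_comp _ _ _ (fun s : R => (s, y)) (fun p : R * V => K p.1 p.2)).
  apply: (@cvg_pair R R V (nbhs t) (nbhs t) (nbhs y) _ _ _ id (cst y)).
    exact: cvg_id.
  exact: cvg_cst.
exact: cK.
Qed.

Lemma continuous_param_int01 (K : R -> V -> R) :
  continuous (fun p : R * V => K p.1 p.2) -> continuous (fun y => int01 (K^~ y)).
Proof.
move=> cK y; apply/cvgrPdist_le => e e0.
have := param_unif y cK e0; apply: filterS => z Kz.
rewrite -int01B; [|exact: continuous_slice..].
apply: int01_bound.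
  by move=> t; apply: cvgB; exact: continuous_slice.
by move=> t /Kz; rewrite distrC.
Qed.

(** The mean value theorem rewrites the difference quotient of [K t] as [L t] at an intermediate
    point. That point depends on [t], which is why the continuity of [L] is used uniformly in
    [t]. *)
Lemma is_derive_param_int01 (K L : R -> V -> R) (v : V) :
  continuous (fun p : R * V => K p.1 p.2) -> continuous (fun p : R * V => L p.1 p.2) ->
  (forall t y, is_derive y v (K t) (L t y)) ->
  forall y, is_derive y v (fun z => int01 (K^~ z)) (int01 (L^~ y)).
Proof.
move=> cK cL dK y.
have C : h^-1 *: (((fun z => int01 (K^~ z)) \o shift y) (h *: v) - int01 (K^~ y))
    @[h --> (0:R)^'] --> int01 (L^~ y).
  apply/cvgrPdist_le => e e0.
  have := param_unif y cL e0 => /nbhs_ballP[d /= d0 Hd].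
  (* The [+ 1] keeps the divisor positive when [v = 0]. *)
  have dv : 0 < d / (`|v| + 1) by rewrite divr_gt0// ltr_wpDl.
  near=> h.
  have h0 : h != 0 by near: h; exact: nbhs_dnbhs_neq.
  have hd : `|h| < d / (`|v| + 1) by near: h; exact: dnbhs0_lt.
  have cKs z : continuous (K^~ z) by exact: continuous_slice.
  have cLs z : continuous (L^~ z) by exact: continuous_slice.
  have cD : continuous (fun t => K t (h *: v + y) - K t y).
    by move=> t; apply: cvgB; exact: cKs.
  rewrite /= /GRing.scale/= -int01B// -int01Z// -int01B//; last first.
    by move=> t; apply: cvgM; [exact: cvg_cst|exact: cD].
  apply: int01_bound.
    by move=> t; apply: cvgB; [exact: cLs|apply: cvgM; [exact: cvg_cst|exact: cD]].
  move=> t t01.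
  have [|s sh ->] := @MVT_line R V (K t) y v h.
    by move=> s _; have [] := dK t (s *: v + y).
  rewrite mulKf//; have [_ ->] := dK t (s *: v + y).
  rewrite distrC; apply: Hd => //.
  rewrite -ball_normE /= distrC addrK normrZ.
  rewrite ltr_pdivlMr ?ltr_wpDl// in hd.
  apply: le_lt_trans hd; apply: ler_pM => //.
  by rewrite lerDl.
apply: DeriveDef; first by apply/cvg_ex; exists (int01 (L^~ y)).
exact: cvg_lim C.
Unshelve. all: by end_near. Qed.

End Parametric.

Section Hadamard.
Variables (R : realType) (n : nat).
Local Notation rV := 'rV[R]_n.
Local Notation e i := (delta_mx 0 i : rV).

Lemma continuous_homothety (H : rV -> R) (q : rV) (m : nat) : continuous H ->
  continuous (fun p : R * rV => p.1 ^+ m * H (p.1 *: p.2 + (q - p.1 *: q))).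
Proof.
move=> cH [t y].
have c1 : {for (t, y), continuous (fun p : R * rV => p.1 : R)} by exact: cvg_fst.
have c2 : {for (t, y), continuous (fun p : R * rV => p.2 : rV)} by exact: cvg_snd.
have ca : {for (t, y), continuous (fun p : R * rV => p.1 *: p.2 + (q - p.1 *: q))}.
  apply: cvgD; first exact: cvgZ.
  apply: cvgB; first exact: cvg_cst.
  exact: cvgZr_tmp.
have cm : {for (t, y), continuous (fun p : R * rV => p.1 ^+ m)}.
  elim: (m) => [|k IH]; first exact: cvg_cst.
  have -> : (fun p : R * rV => p.1 ^+ k.+1) = (fun p => p.1 * p.1 ^+ k).
    by apply/funext => p; rewrite exprS.
  exact: (cvgM c1 IH).
apply: (cvgM cm).
exact: (continuous_comp ca (cH _)).
Qed.

Lemma is_derive_homothety (H : rV -> R) (b y v : rV) (t : R) :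
  differentiable H (t *: y + b) ->
  is_derive y v (fun z => H (t *: z + b)) (t * 'D_v H (t *: y + b)).
Proof.
move=> dH.
have da : differentiable (fun z : rV => t *: z + b) y.
  by apply: differentiableD => //; exact: differentiableZ.
have dHa : differentiable (H \o (fun z : rV => t *: z + b)) y by exact: differentiable_comp.
apply: DeriveDef; first exact: diff_derivable.
have Dl : 'D_v (fun z : rV => t *: z + b) y = t *: v.
  rewrite (@deriveD _ _ _ (fun z : rV => t *: z) (cst b)) ?derive_cst ?addr0//.
    by rewrite (@deriveZ _ _ _ id) ?derive_id//.
by rewrite deriveE// diff_comp//= (deriveE v dH) -(deriveE v da) Dl linearZ.
Qed.

(** With [m = 0] and a partial derivative of a function in place of [H], this is the coefficient of
    Hadamard's lemma. The power of [t] records the factors that derivations in [y] bring out. *)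
Definition homothety_mean (H : rV -> R) (q : rV) (m : nat) (y : rV) : R :=
  int01 (fun t => t ^+ m * H (t *: y + (q - t *: q))).

Lemma Ck_homothety_mean k (H : rV -> R) (q : rV) m :
  smooth_on setT H -> Ck k setT (homothety_mean H q m).
Proof.
elim: k H m => [|k IH] H m sH.
all: have cH : continuous H by move=> x; apply: (Ck_continuous (sH 0)); rewrite inE.
all: have cI : continuous (homothety_mean H q m) by
  apply: (@continuous_param_int01 R _ (fun t y => t ^+ m * H (t *: y + (q - t *: q))));
  exact: continuous_homothety.
  by split => // x _; exact: cI.
split=> [x _|i]; first exact: cI.
have sdH : smooth_on setT ('D_(e i) H) by move=> j; have [_ /(_ i)[]] := sH j.+1.
have cdH : continuous ('D_(e i) H).
  by move=> x; apply: (Ck_continuous (sdH 0)); rewrite inE.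
have d y : is_derive y (e i) (homothety_mean H q m) (homothety_mean ('D_(e i) H) q m.+1 y).
  apply: (@is_derive_param_int01 R _ (fun t y => t ^+ m * H (t *: y + (q - t *: q)))
    (fun t y => t ^+ m.+1 * 'D_(e i) H (t *: y + (q - t *: q)))).
  - exact: continuous_homothety.
  - exact: (@continuous_homothety ('D_(e i) H) q m.+1 cdH).
  move=> t z.
  have dH := Ck_differentiable openT (sH 1) (I : setT (t *: z + (q - t *: q))).
  apply: is_derive_eq (is_deriveM (is_derive_cst (t ^+ m) z (e i))
    (is_derive_homothety (e i) dH)) _.
  by rewrite scaler0 addr0 /GRing.scale /= mulrA exprSr.
split; first by move=> y _; have [] := d y.
apply: (@Ck_ext _ _ _ _ (homothety_mean ('D_(e i) H) q m.+1)); first exact: openT.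
  by move=> y _; have [_ ->] := d y.
exact: IH.
Qed.

(** The fundamental theorem of calculus along the segment from [q] to [y], whose velocity [y - q] is
    split into coordinates. At [y = q] the integrand of each coefficient is constant. *)
Lemma hadamard (H : rV -> R) (q : rV) : smooth_on setT H ->
  exists h : 'I_n -> rV -> R, [/\ forall i, smooth_on setT (h i),
    forall i, h i q = 'D_(e i) H q &
    forall y, H y = H q + \sum_i (y 0 i - q 0 i) * h i y].
Proof.
move=> sH; exists (fun i => homothety_mean ('D_(e i) H) q 0).
have sdH i : smooth_on setT ('D_(e i) H) by move=> j; have [_ /(_ i)[]] := sH j.+1.
have cdH i : continuous ('D_(e i) H).
  by move=> x; apply: (Ck_continuous (sdH i 0)); rewrite inE.
split=> [i k|i|y].
- exact: Ck_homothety_mean.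
- rewrite -[RHS]int01_cst; apply: eq_int01 => t _.
  by rewrite expr0 mul1r addrC subrK.
apply/eqP; rewrite addrC -subr_eq; apply/eqP.
have dH (z : rV) := Ck_differentiable openT (sH 1) (I : setT z).
have cs i : continuous (fun t : R => t ^+ 0 * 'D_(e i) H (t *: y + (q - t *: q))).
  apply: (@continuous_slice R _ (fun t y => t ^+ 0 * 'D_(e i) H (t *: y + (q - t *: q)))).
  exact: (@continuous_homothety ('D_(e i) H) q 0 (cdH i)).
have E : (fun t => \sum_i (y 0 i - q 0 i) * (t ^+ 0 * 'D_(e i) H (t *: y + (q - t *: q)))) =
   (fun t : R => 'D_(y - q) H (t *: (y - q) + q)).
  apply/funext => t; rewrite deriveE//.
  have [_ ->] := C1_differentiable openT (sH 1) (I : setT (t *: (y - q) + q)).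
  apply: eq_bigr => i _; rewrite !mxE expr0 mul1r.
  by rewrite scalerBr -addrA (addrC (- _)).
have cE : continuous (fun t : R => 'D_(y - q) H (t *: (y - q) + q)).
  rewrite -E; apply: continuous_sumr => i _ t.
  by apply: cvgM; [exact: cvg_cst|exact: cs].
under eq_bigr => i _ do rewrite /homothety_mean -(int01Z _ (cs i)).
rewrite -int01_sum; last by move=> i t; apply: cvgM; [exact: cvg_cst|exact: cs].
have dl (t : R) : is_derive t 1 (fun t : R => H (t *: (y - q) + q))
    ('D_(y - q) H (t *: (y - q) + q)).
  by apply: is_derive_line; exact: diff_derivable.
by rewrite E (int01_derive dl cE) scale1r scale0r add0r subrK.
Qed.

End Hadamard.

(** * Smooth functions and tangent vectors on a manifold *)

Section ChartExt.
Variables (R : realType) (n : nat) (M : manifold R n).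
Local Notation rV := 'rV[R]_n.
Local Notation C := (smooth_fun M).
Implicit Types (c : chart R n M) (G : rV -> R) (q : rV) (s : R).

Lemma smooth_fun_eq (f g : C) : (forall x, f x = g x) -> f = g.
Proof. by move=> fg; apply: val_inj; apply/funext. Qed.

Lemma smooth_sumE (I : Type) (r : seq I) (f : I -> C) (x : M) :
  (\sum_(i <- r) f i) x = \sum_(i <- r) f i x.
Proof. by elim/big_rec2: _ => [//|i a b _ <-]. Qed.

Lemma open_chart_inv c (A : set M) : open A ->
  open (chart_img c `&` chart_inv c @^-1` A).
Proof.
move=> oA; rewrite openE => z [cz Az]; apply: filterI.
  by apply: open_nbhs_nbhs; split => //; exact: chart_img_open.
have zc : z \in chart_img c by rewrite inE.
by apply: (chart_inv_continuous zc); exact: open_nbhs_nbhs.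
Qed.

Lemma open_chart_map c (A : set rV) : open A ->
  open (chart_dom c `&` chart_map c @^-1` A).
Proof.
move=> oA; rewrite openE => z [cz Az]; apply: filterI.
  by apply: open_nbhs_nbhs; split => //; exact: chart_dom_open.
have zc : z \in chart_dom c by rewrite inE.
by apply: (chart_map_continuous zc); exact: open_nbhs_nbhs.
Qed.

Lemma open_row_ball q s : open [set z : rV | `|z - q| < s].
Proof.
have -> : [set z : rV | `|z - q| < s] = ball q s.
  by apply/seteqP; split => z /=; rewrite -ball_normE /= distrC.
exact: ball_open.
Qed.

Lemma open_row_ballC q s : open [set z : rV | s < `|z - q|].
Proof.
rewrite openE => z /= zs; apply/nbhs_ballP; exists (`|z - q| - s) => /=.
  by rewrite subr_gt0.
move=> y; rewrite -ball_normE /= => zy.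
by have := ler_distD y z q; lra.
Qed.

Lemma compact_row_ball q s : compact [set z : rV | `|z - q| <= s].
Proof.
apply: bounded_closed_compact.
  exists (s + `|q|); split; first exact: num_real.
  move=> t st z /= zq; apply: ltW; apply: le_lt_trans st.
  by rewrite -{1}(subrK q z) (le_trans (ler_normD _ _))// lerD2r.
rewrite -openC (_ : ~` _ = [set z : rV | s < `|z - q|]); first exact: open_row_ballC.
by apply/seteqP; split => z /=; rewrite ltNge => /negP.
Qed.

Definition chart_ext c G (x : M) : R :=
  if `[< chart_dom c x >] then G (chart_map c x) else 0.

Lemma chart_extE c G x : chart_dom c x -> chart_ext c G x = G (chart_map c x).
Proof. by rewrite /chart_ext => cx; rewrite asboolT. Qed.

Lemma chart_extN c G x : ~ chart_dom c x -> chart_ext c G x = 0.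
Proof. by rewrite /chart_ext => cx; rewrite asboolF. Qed.

(** The delicate points are those outside the domain of [c]. The closed ball is compact, so its
    image [L] in M is compact, hence closed since M is Hausdorff, and the extension vanishes on the
    open complement of [L]. *)
Lemma smooth_chart_ext c q s G : atlas c ->
  (forall z, `|z - q| <= s -> chart_img c z) -> smooth_on (chart_img c) G ->
  (forall z, s < `|z - q| -> G z = 0) -> smooth (chart_ext c G).
Proof.
move=> ac qs sG G0 c' ac' k; apply: Ck_local => y cy.
have [cx|cx] := pselect (chart_dom c (chart_inv c' y)).
  pose V := chart_img c' `&` chart_inv c' @^-1` chart_dom c.
  have oV : open V by apply: open_chart_inv; exact: chart_dom_open.
  exists V => //.
  apply: (@Ck_ext _ _ _ _ (G \o (chart_map c \o chart_inv c'))) => //.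
    by move=> z /set_mem[_ cz]; rewrite /= chart_extE.
  apply: (@Ck_comp _ _ _ _ _ (chart_img c)) => //.
  - exact: chart_img_open.
  - by move=> j; exact: (atlas_compatible ac' ac j k).
  - by move=> z [_ cz]; exact: chart_mapP.
pose L := chart_inv c @` [set z : rV | `|z - q| <= s].
have cL : closed L.
  apply: compact_closed; first exact: manifold_hausdorff.
  apply: continuous_compact; last exact: compact_row_ball.
  apply: continuous_in_subspaceT => z /set_mem /= zq.
  by apply: chart_inv_continuous; rewrite inE; exact: qs.
pose V := chart_img c' `&` chart_inv c' @^-1` (~` L).
have oV : open V by apply: open_chart_inv; rewrite openC.
exists V.
  split => //= -[z zq zy]; apply: cx; rewrite -zy.
  by apply: chart_invP; exact: qs.
apply: (@Ck_ext _ _ _ _ (cst 0)) => //; last exact: Ck_cst.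
move=> z /set_mem[_ /= nL].
have [cz|cz] := pselect (chart_dom c (chart_inv c' z)); last by rewrite chart_extN.
rewrite chart_extE// G0// ltNge; apply/negP => zq; apply: nL.
by exists (chart_map c (chart_inv c' z)) => //; apply: chart_mapK; rewrite inE.
Qed.

Lemma chart_ball c x : chart_dom c x ->
  exists2 r : R, 0 < r & forall z, `|z - chart_map c x| < r -> chart_img c z.
Proof.
move=> cx; have : nbhs (chart_map c x) (chart_img c).
  by apply: open_nbhs_nbhs; split; [exact: chart_img_open|exact: chart_mapP].
move=> /nbhs_ballP[r /= r0 H]; exists r => // z zr; apply: H.
by rewrite -ball_normE /= distrC.
Qed.

(** This is what makes derivations of the global algebra local. *)
Lemma bump_at (x : M) (N : set M) : nbhs x N ->
  exists psi : C, psi x = 1 /\ forall y, ~ N y -> psi y = 0.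
Proof.
move=> xN; have [c ac cx] := atlas_cover x.
pose q := chart_map c x.
have qc : q \in chart_img c by rewrite inE; exact: chart_mapP.
have : nbhs q (chart_img c `&` chart_inv c @^-1` N).
  apply: filterI; first by apply: open_nbhs_nbhs; split; [exact: chart_img_open|exact/set_mem].
  apply: (chart_inv_continuous qc).
  by rewrite chart_mapK ?inE.
move=> /nbhs_ballP[r /= r0 H].
have {}H z : `|z - q| < r -> chart_img c z /\ N (chart_inv c z).
  by move=> zr; apply: H; rewrite -ball_normE /= distrC.
(* The cutoff vanishes at distance [2 * (r / 4)] and beyond, strictly inside the ball of radius
   [r]. *)
have r4 : 0 < r / 4 by rewrite divr_gt0.
have [chi [schi chi1 chi0]] := cutoff_exists q r4.
have sx : smooth (chart_ext c chi).
  apply: (@smooth_chart_ext c q (2 * (r / 4))) => //.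
  - by move=> z zr; apply: (H _ _).1; apply: le_lt_trans zr _; lra.
  - exact/schi/chart_img_open.
  - by move=> z /ltW; exact: chi0.
exists (mk_smooth sx); split.
  by rewrite /= chart_extE// chi1// subrr normr0 ltW.
move=> y Ny /=; have [cy|cy] := pselect (chart_dom c y); last by rewrite chart_extN.
rewrite chart_extE// chi0// leNgt; apply/negP => yr; apply: Ny.
rewrite -(chart_mapK (mem_set cy)); apply: (H _ _).2; apply: lt_trans yr _; lra.
Qed.

End ChartExt.

Section TangentTheory.
Variables (R : realType) (n : nat) (M : manifold R n) (x : M).
Local Notation C := (smooth_fun M).
Implicit Types (v : tangent x) (b : cotangent x).

Lemma tangentL v (a : R) (f g : C) : v (a *: f + g) = a * v f + v g.
Proof. by have [+ _] := tangentP v; apply. Qed.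

Lemma tangentM v (f g : C) : v (f * g) = v f * g x + f x * v g.
Proof. by have [_] := tangentP v; apply. Qed.

Lemma tangentD v (f g : C) : v (f + g) = v f + v g.
Proof. by have := tangentL v 1 f g; rewrite scale1r mul1r. Qed.

Lemma tangent0 v : v 0 = 0.
Proof.
by have := tangentD v 0 0; rewrite addr0 => /eqP; rewrite addrC -subr_eq subrr eq_sym => /eqP.
Qed.

Lemma tangentZ v (a : R) (f : C) : v (a *: f) = a * v f.
Proof. by have := tangentL v a f 0; rewrite addr0 tangent0 addr0. Qed.

Lemma tangentN v (f : C) : v (- f) = - v f.
Proof. by rewrite -scaleN1r tangentZ mulN1r. Qed.

Lemma tangent_sum v (I : Type) (r : seq I) (f : I -> C) :
  v (\sum_(i <- r) f i) = \sum_(i <- r) v (f i).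
Proof. by elim/big_rec2: _ => [|i a b _ <-]; rewrite ?tangent0 ?tangentD. Qed.

Lemma tangent_const v (a : R) : v (smooth_const M a) = 0.
Proof.
have -> : smooth_const M a = a *: (1 : C).
  by apply: smooth_fun_eq => y; exact: (esym (mulr1 a)).
rewrite tangentZ; have := tangentM v 1 1; rewrite mul1r mulr1 mul1r => /eqP.
by rewrite addrC -subr_eq subrr eq_sym => /eqP ->; rewrite mulr0.
Qed.

Lemma tangent_eq (u v : tangent x) : (forall f, u f = v f) -> u = v.
Proof. by move=> uv; apply: val_inj; apply/funext. Qed.

(** Take a bump supported in the zero set of [h]: then [h * psi = 0] on all of M, while the product
    rule gives [v (h * psi) = v h]. *)
Lemma tangent_near0 v (h : C) : (\forall y \near x, h y = 0) -> v h = 0.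
Proof.
move=> h0; have [psi [psi1 psi0]] := bump_at h0.
have hx : h x = 0 := nbhs_singleton h0.
have : h * psi = 0.
  apply: smooth_fun_eq => y; change (h y * psi y = 0).
  have [hy|hy] := pselect (h y = 0).
    by rewrite hy mul0r.
  by rewrite (psi0 _ hy) mulr0.
by move=> /(congr1 v); rewrite tangentM psi1 hx mulr1 mul0r addr0 tangent0.
Qed.

Lemma tangent_near_eq v (f g : C) : (\forall y \near x, f y = g y) -> v f = v g.
Proof.
move=> fg; apply/eqP; rewrite -subr_eq0 -tangentN -tangentD; apply/eqP.
by apply: tangent_near0; apply: filterS fg => y fgy; change (f y - g y = 0); rewrite fgy subrr.
Qed.

Lemma tangent_lin_sumE (I : Type) (r : seq I) (a : I -> R) (u : I -> tangent x) (f : C) :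
  (\sum_(i <- r) a i *: u i) f = \sum_(i <- r) a i * u i f.
Proof. by elim/big_rec2: _ => [//|i w t _ <-]. Qed.

Lemma cotangentL b (a : R) (u v : tangent x) : b (a *: u + v) = a * b u + b v.
Proof. by have := cotangentP b a u v. Qed.

Lemma cotangent0 b : b 0 = 0.
Proof. by have := cotangentL b (-1) 0 0; rewrite scaler0 addr0 mulN1r addNr. Qed.

Lemma cotangent_sum b (I : Type) (r : seq I) (a : I -> R) (u : I -> tangent x) :
  b (\sum_(i <- r) a i *: u i) = \sum_(i <- r) a i * b (u i).
Proof. by elim/big_rec2: _ => [|i w t _ <-]; rewrite ?cotangent0 ?cotangentL. Qed.

Lemma cotangent_eq (a b : cotangent x) : (forall v, a v = b v) -> a = b.
Proof. by move=> ab; apply: val_inj; apply/funext. Qed.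

End TangentTheory.

(** * Local frames *)

Section Frame.
Variables (R : realType) (n : nat) (M : manifold R n).
Local Notation rV := 'rV[R]_n.
Local Notation C := (smooth_fun M).
Local Notation e i := (delta_mx 0 i : rV).

Lemma CkMl k (U : set rV) (f g : rV -> R) : open U -> Ck k U f -> Ck k U g ->
  Ck k U (fun z => f z * g z).
Proof. exact: CkM. Qed.

(* chi d/dz_i, extended by zero outside of the chart *)
Definition coord_field (c : chart R n M) (chi : rV -> R) (i : 'I_n) (x : M) (g : C) : R^o :=
  chart_ext c (fun z => chi z * 'D_(e i) (g \o chart_inv c) z) x.

Lemma coord_field_derivation c chi i x : atlas c ->
  coord_field c chi i x \in @tangent_pred R n M x.
Proof.
move=> ac; apply/asboolP.
have [cx|cx] := pselect (chart_dom c x); last first.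
  split=> [a f g|f g]; rewrite /coord_field !(chart_extN _ cx).
    by rewrite /GRing.scale /= mulr0 addr0.
  by rewrite mul0r mulr0 addr0.
set z := chart_map c x.
have zc : z \in chart_img c by rewrite inE; exact: chart_mapP.
have zK : chart_inv c z = x by rewrite chart_mapK ?inE.
have d (f : C) : derivable (f \o chart_inv c) z (e i).
  by have [_ /(_ i)[+ _]] := smooth_funP f ac 1; apply.
split=> [a f g|f g]; rewrite /coord_field !(chart_extE _ cx) -/z.
  have -> : (a *: f + g : C) \o chart_inv c =
    a \*: (f \o chart_inv c) + (g \o chart_inv c) by [].
  rewrite deriveD//; last exact: derivableZ.
  by rewrite deriveZ// /GRing.scale /=; ring.
have -> : (f * g : C) \o chart_inv c = (f \o chart_inv c) * (g \o chart_inv c) by [].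
by rewrite deriveM// /GRing.scale /= zK; ring.
Qed.

Definition coord_tangent c chi i x (ac : atlas c) : tangent x :=
  Tangent (coord_field_derivation chi i x ac).

(** The witnesses are the cut-off coordinates and coordinate fields. The spanning property is
    claimed on a neighbourhood, not just at the point, since expansions in the frame will be
    differentiated. *)
Lemma local_frame (p : M) :
  exists (f : 'I_n -> C) (X : 'I_n -> forall x : M, tangent x) (phi : C) (W : set M),
  [/\ forall i, smooth_vector_field (X i), open W /\ W p, forall x, W x -> phi x = 1 &
    forall x, phi x != 0 -> \forall y \near x, forall v : tangent y,
      v = \sum_i v (f i) *: X i y].
Proof.
have [c ac cp] := atlas_cover p.
pose q := chart_map c p.
have [r8 r80 qimg] := chart_ball cp.
pose r := r8 / 8.
have r0 : 0 < r by rewrite divr_gt0.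
(* [phi] is supported in the ball of radius 2r, on which [chi] is 1; [chi] is
   supported in the ball of radius 4r, which is contained in the chart. *)
have r20 : 0 < 2 * r by rewrite mulr_gt0.
have [phi0 [sphi phi1 phiN]] := cutoff_exists q r0.
have [chi [schi chi1 chiN]] := cutoff_exists q r20.
have oimg : open (chart_img c) by exact: chart_img_open.
have img4 z : `|z - q| <= 2 * (2 * r) -> chart_img c z.
  by move=> zr; apply: qimg; rewrite (le_lt_trans zr)// /r; lra.
have sphiM : smooth (chart_ext c phi0).
  apply: (@smooth_chart_ext R n M c q (2 * r)) => //.
  - by move=> z zr; apply: img4; lra.
  - exact: sphi.
  - by move=> z /ltW; exact: phiN.
have sextM G : smooth_on (chart_img c) G -> smooth (chart_ext c (fun z => chi z * G z)).
  move=> sG; apply: (@smooth_chart_ext R n M c q (2 * (2 * r))) => //.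
  - by move=> k; apply: CkMl => //; exact: schi.
  - by move=> z /ltW zr; rewrite chiN ?mul0r.
pose ext G (sG : smooth_on (chart_img c) G) : C := mk_smooth (sextM G sG).
have scoord i : smooth_on (chart_img c) (fun z => z 0 i) by move=> k; exact: Ck_coord.
pose f i : C := ext _ (scoord i).
pose X i x : tangent x := coord_tangent chi i x ac.
pose W := chart_dom c `&` chart_map c @^-1` [set z | `|z - q| < r].
exists f, X, (mk_smooth sphiM), W; split.
- move=> i g; apply: (sextM ('D_(e i) (g \o chart_inv c))) => k.
  by have [_ /(_ i)[]] := smooth_funP g ac k.+1.
- split; first by apply: open_chart_map; exact: open_row_ball.
  by split => //=; rewrite subrr normr0.
- by move=> x [cx /= xr]; rewrite chart_extE// phi1// ltW.
pose O := chart_dom c `&` chart_map c @^-1` [set z | `|z - q| < 2 * r].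
have oO : open O by apply: open_chart_map; exact: open_row_ball.
move=> x /= phix.
have Ox : O x.
  have cx : chart_dom c x by apply: contrapT => cx; rewrite chart_extN ?eqxx in phix.
  split => //=; rewrite ltNge; apply/negP => xr.
  by rewrite chart_extE// phiN// eqxx in phix.
have : nbhs x O by exact: open_nbhs_nbhs.
apply: filterS => {phix Ox}x Ox v; have [cx /= xr] := Ox.
apply: tangent_eq => g.
set u := chart_map c x.
have uK : chart_inv c u = x by rewrite chart_mapK ?inE.
have cu : chart_img c u by exact: chart_mapP.
(* Multiplying by [chi] gives a smooth function on the whole space, so Hadamard's segments never
   leave its domain; near [u] it is still [g] read in the chart. *)
pose G z := chi z * g (chart_inv c z).
have sG : smooth_on setT G.
  move=> k; apply: Ck_local => z _.
  have [zc|zc] := pselect (chart_img c z).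
    exists (chart_img c) => //; apply: CkMl => //; first exact: schi.
    exact: (smooth_funP g ac k).
  exists [set z | 2 * (2 * r) < `|z - q|].
    by rewrite /= ltNge; apply/negP => /img4.
  apply: (@Ck_ext _ _ _ _ (cst 0)); [exact: open_row_ballC| |exact: Ck_cst].
  by move=> y /set_mem /= /ltW yr; rewrite /G chiN// mul0r.
have [h [sh hu GE]] := hadamard u sG.
have sh' i : smooth_on (chart_img c) (h i) by move=> k; apply: Ck_subset (sh i k).
pose H i : C := ext _ (sh' i).
(* The Hadamard expansion of [G] at [u], carried to M by global functions. Since [f i - u_i]
   vanishes at [x], the product rule leaves only [v (f i)] times the value of [h i] at [u]. *)
pose T : C := smooth_const M (G u) + \sum_i (f i - smooth_const M (u 0 i)) * H i.
have TE y : T y = G u + \sum_i (f i y - u 0 i) * H i y.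
  change (G u + (\sum_i (f i - smooth_const M (u 0 i)) * H i : C) y =
    G u + \sum_i (f i y - u 0 i) * H i y).
  by rewrite smooth_sumE.
have extO G' sG' y : O y -> ext G' sG' y = G' (chart_map c y).
  by move=> [cy /= /ltW yr]; rewrite /ext /= chart_extE// chi1// mul1r.
have fE i y : O y -> f i y = chart_map c y 0 i := @extO _ (scoord i) y.
have HE i y : O y -> H i y = h i (chart_map c y) := @extO _ (sh' i) y.
have gT : v g = v T.
  apply: tangent_near_eq.
  have : nbhs x O by exact: open_nbhs_nbhs.
  apply: filterS => y Oy; rewrite TE.
  have [cy /= /ltW yr] := Oy.
  have := GE (chart_map c y); rewrite {1}/G chi1// mul1r chart_mapK ?inE// => ->.
  congr (_ + _); apply: eq_bigr => i _.
  by congr ((_ - _) * _); [exact: esym (fE i y Oy)|exact: esym (HE i y Oy)].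
have vsum : (\sum_i v (f i) *: X i x) g = \sum_i v (f i) * X i x g.
  exact: tangent_lin_sumE.
rewrite gT /T tangentD tangent_const add0r tangent_sum vsum.
apply: eq_bigr => i _.
rewrite tangentM tangentD tangentN tangent_const subr0.
have -> : (f i - smooth_const M (u 0 i)) x = 0.
  by change (f i x - u 0 i = 0); rewrite fE// subrr.
rewrite mul0r addr0 HE//; congr (_ * _).
rewrite hu /= /coord_field chart_extE// chi1 ?mul1r; last exact: ltW.
apply: near_eq_derive.
have : nbhs u [set z | `|z - q| < 2 * r].
  by apply: open_nbhs_nbhs; split => //; exact: open_row_ball.
by apply: filterS => z /ltW zr; rewrite /G chi1// mul1r.
Qed.

End Frame.

(** * Poisson tensors *)

Section PoissonTensor.
Variables (R : realType) (n : nat) (M : manifold R n).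
Local Notation C := (smooth_fun M).
Variable Pi : bivector M.

Section AtPoint.
Variable x : M.
Implicit Types (a b : cotangent x) (k : R).

Lemma bivectorLl k a a' b : Pi x (k *: a + a') b = k * Pi x a b + Pi x a' b.
Proof. exact: (bivector_linear Pi b k a a'). Qed.

Lemma bivectorDl a a' b : Pi x (a + a') b = Pi x a b + Pi x a' b.
Proof. by have := bivectorLl 1 a a' b; rewrite scale1r mul1r. Qed.

Lemma bivector0l b : Pi x 0 b = 0.
Proof. by have := bivectorLl (-1) 0 0 b; rewrite scaler0 addr0 mulN1r addNr. Qed.

Lemma bivectorZl k a b : Pi x (k *: a) b = k * Pi x a b.
Proof. by have := bivectorLl k a 0 b; rewrite addr0 bivector0l addr0. Qed.

Lemma bivectorDr a b b' : Pi x a (b + b') = Pi x a b + Pi x a b'.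
Proof. by rewrite bivector_skew bivectorDl opprD -!(bivector_skew _ a). Qed.

Lemma bivectorZr k a b : Pi x a (k *: b) = k * Pi x a b.
Proof. by rewrite bivector_skew bivectorZl -mulrN -(bivector_skew _ a). Qed.

Lemma bivector_suml (I : Type) (r : seq I) (a : I -> cotangent x) b :
  Pi x (\sum_(i <- r) a i) b = \sum_(i <- r) Pi x (a i) b.
Proof. by elim/big_rec2: _ => [|i u v _ <-]; rewrite ?bivector0l ?bivectorDl. Qed.

Lemma bivector_sumr (I : Type) (r : seq I) a (b : I -> cotangent x) :
  Pi x a (\sum_(i <- r) b i) = \sum_(i <- r) Pi x a (b i).
Proof.
rewrite bivector_skew bivector_suml -sumrN; apply: eq_bigr => i _.
by rewrite -bivector_skew.
Qed.

Lemma diff_atD (f g : C) : diff_at x (f + g) = diff_at x f + diff_at x g.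
Proof. by apply: cotangent_eq => v; exact: tangentD. Qed.

Lemma diff_atM (f g : C) : diff_at x (f * g) = f x *: diff_at x g + g x *: diff_at x f.
Proof.
by apply: cotangent_eq => v; rewrite [LHS]tangentM addrC [v f * _]mulrC.
Qed.

Lemma cotangent_expand (f : 'I_n -> C) (u : 'I_n -> tangent x) b :
  (forall v : tangent x, v = \sum_i v (f i) *: u i) ->
  b = \sum_i b (u i) *: diff_at x (f i).
Proof.
move=> fu; apply: cotangent_eq => v; rewrite {1}(fu v) cotangent_sum.
have -> : (\sum_i b (u i) *: diff_at x (f i)) v = \sum_i b (u i) * v (f i).
  by elim/big_rec2: _ => [//|i p q _ <-].
by apply: eq_bigr => i _; rewrite mulrC.
Qed.

(** [sharp] is a choice with default 0, so a suitable vector must be exhibited. In a frame it is the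
    combination of the [X_i] with coefficients [Pi(a, df_i)]; this is where finite dimension
    enters. *)
Lemma sharpP a b : b (sharp Pi a) = Pi x a b.
Proof.
have [f [X [phi [W [_ [_ Wx] phi1 /(_ x)]]]]] := local_frame x.
rewrite phi1// oner_neq0 => /(_ isT) /nbhs_singleton fr.
suff : [set v : tangent x | forall b : cotangent x, b v = Pi x a b] (sharp Pi a) by exact.
apply: (@xgetPex _ 0); exists (\sum_i Pi x a (diff_at x (f i)) *: X i x) => b'.
rewrite cotangent_sum {2}(cotangent_expand b' fr) bivector_sumr.
by apply: eq_bigr => i _; rewrite bivectorZr mulrC.
Qed.

Lemma sharpE a (f : C) : sharp Pi a f = Pi x a (diff_at x f).
Proof. exact: sharpP a (diff_at x f). Qed.

End AtPoint.

Lemma bracketE (f g : C) x : bracket Pi f g x = Pi x (diff_at x f) (diff_at x g).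
Proof. by []. Qed.

Lemma bracketC (f g : C) : bracket Pi f g = - bracket Pi g f.
Proof. by apply: smooth_fun_eq => x; exact: bivector_skew. Qed.

Lemma diff_atN x (f : C) : diff_at x (- f) = - diff_at x f.
Proof. by apply: cotangent_eq => v; exact: tangentN. Qed.

(** The Jacobi identity read as invariance: the Hamiltonian field of [f] acts as a derivation of the
    bracket. *)
Lemma jacobi_leibniz : jacobi Pi -> forall (f g h : C),
  bracket Pi f (bracket Pi g h) =
  bracket Pi (bracket Pi f g) h + bracket Pi g (bracket Pi f h).
Proof.
move=> J f g h; have := J f g h.
rewrite (bracketC h f) (bracketC h (bracket Pi f g)).
have -> : bracket Pi g (- bracket Pi f h) = - bracket Pi g (bracket Pi f h).
  apply: smooth_fun_eq => x; change (Pi x (diff_at x g) (diff_at x (- bracket Pi f h)) =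
    - Pi x (diff_at x g) (diff_at x (bracket Pi f h))).
  by rewrite diff_atN -scaleN1r bivectorZr mulN1r.
by move=> /eqP; rewrite -addrA addr_eq0 opprD !opprK addrC => /eqP.
Qed.

End PoissonTensor.

(** * Locally finite frames *)

Section Glue.
Variables (R : realType) (n : nat) (M : manifold R n).
Local Notation C := (smooth_fun M).

(* The fields and functions are globally defined, but they only form a frame
   near the points where [frame_weight] does not vanish. *)
Record frame := Frame {
  frame_fun : 'I_n -> C;
  frame_field : 'I_n -> forall x : M, tangent x;
  frame_weight : C;
  frame_core : set M;
  frame_field_smooth : forall i, smooth_vector_field (frame_field i);
  frame_core_open : open frame_core;
  frame_weight_core : forall x, frame_core x -> frame_weight x = 1;
  frame_near : forall x, frame_weight x != 0 -> \forall y \near x,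
    forall v : tangent y, v = \sum_i v (frame_fun i) *: frame_field i y }.

Lemma frame_at (p : M) : exists F : frame, frame_core F p.
Proof.
have [f [X [phi [W [sX [oW Wp] phi1 fr]]]]] := local_frame p.
by exists (Frame sX oW phi1 fr).
Qed.

(* M may be empty, so [frame_at] does not give a default value. *)
Lemma frame_void : exists F : frame, frame_core F = set0.
Proof.
have sX (i : 'I_n) : smooth_vector_field (fun x : M => 0 : tangent x).
  by move=> f; exact: (@smooth_cst R n M 0).
have w1 x : set0 x -> (0 : C) x = 1 by [].
have fr x : (0 : C) x != 0 -> \forall y \near x, forall v : tangent y,
    v = \sum_(i < n) v (0 : C) *: (0 : tangent y).
  by move=> /negP; case; apply/eqP.
by exists (@Frame (fun=> 0) (fun _ x => 0) 0 set0 sX open0 w1 fr).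
Qed.

(* For each basic open set contained in the core of some frame, pick one such
   frame. *)
Lemma frame_cover : exists F : nat -> frame, forall x, exists k, frame_core (F k) x.
Proof.
have [B /countable_injP[g injg] [Bo Bb]] := @manifold_second_countable _ _ M.
have [F0 _] := frame_void.
(* Basic open sets are indexed by their codes under [g]; injectivity leaves at most one set per
   index, and the remaining indices receive the default frame [F0]. *)
have /choice[F FP] : forall k, exists F : frame, forall U, B U -> g U = k ->
    (exists F', U `<=` frame_core F') -> U `<=` frame_core F.
  move=> k; have [[U [F [BU gU UF]]]|H] :=
      pselect (exists U F, [/\ B U, g U = k & U `<=` frame_core F]).
    exists F => U' BU' gU' _; have -> // : U' = U.
    by apply: injg; rewrite ?inE// gU gU'.
  exists F0 => U BU gU [F' UF']; exfalso; apply: H; exists U, F'.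
  by split.
exists F => x; have [F' F'x] := frame_at x.
have : nbhs x (frame_core F').
  by apply: open_nbhs_nbhs; split => //; exact: frame_core_open.
move=> /(Bb x)[U [BU Ux] UF'].
by exists (g U); apply: (FP _ _ BU erefl) => //; exists F'.
Qed.

Lemma smooth_local (f : M -> R) :
  (forall x, exists V (g : M -> R), [/\ open V, V x, smooth g & forall y, V y -> f y = g y]) ->
  smooth f.
Proof.
move=> H c ac k; apply: Ck_local => y cy.
have [V [g [oV Vx sg fg]]] := H (chart_inv c y).
have oI := open_chart_inv (c := c) oV.
exists (chart_img c `&` chart_inv c @^-1` V) => //.
apply: (@Ck_ext _ _ _ _ (g \o chart_inv c)) => //.
  by move=> z /set_mem[_ /= Vz]; rewrite fg.
by apply: Ck_subset (sg c ac k) => z [].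
Qed.

(** Allows a truncation bound that depends on the point to be exchanged for one that is constant on
    an open set. *)
Lemma sum_ord_stable (V : zmodType) (F : nat -> V) a b :
  (forall k, (a <= k)%N -> F k = 0) -> (forall k, (b <= k)%N -> F k = 0) ->
  \sum_(k < a) F k = \sum_(k < b) F k.
Proof.
wlog ab : a b / (a <= b)%N.
  move=> W Fa Fb; have [ab|/ltnW ba] := leqP a b; first exact: W.
  by symmetry; apply: W.
move=> Fa _; rewrite -!(big_mkord xpredT) [RHS](@big_cat_nat _ _ _ a)//=.
by rewrite [X in _ + X]big_nat_cond [X in _ + X]big1 ?addr0// => k /andP[/andP[/Fa]].
Qed.

(** The k-th term is the difference of the products over [j < k] and over [j < k.+1]. *)
Lemma sum_telescope_prod (A : comPzRingType) (f : nat -> A) m :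
  \sum_(k < m) f k * \prod_(j < k) (1 - f j) = 1 - \prod_(k < m) (1 - f k).
Proof.
elim: m => [|m IH]; first by rewrite !big_ord0 subrr.
by rewrite !big_ord_recr /= IH; ring.
Qed.

(** * The partition of unity *)

Section Partition.
Variable F : nat -> frame.

(* Since the weights are 1 on the cores, the functions of index > k vanish on the
   k-th core: the family is locally finite although the cover is not. *)
Definition partition_fun (k : nat) : C :=
  frame_weight (F k) * \prod_(j < k) (1 - frame_weight (F j)).

Lemma partition_fun_neq0 k x : partition_fun k x != 0 -> frame_weight (F k) x != 0.
Proof.
apply: contra_neq => wx.
by change (frame_weight (F k) x * (\prod_(j < k) (1 - frame_weight (F j)) : C) x = 0);
  rewrite wx mul0r.
Qed.

Lemma prod_core_eq0 k m x : frame_core (F k) x -> (k < m)%N ->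
  (\prod_(j < m) (1 - frame_weight (F j)) : C) x = 0.
Proof.
move=> Fkx km; rewrite (bigD1 (Ordinal km)) //=.
set P := (X in _ * X).
change ((1 - frame_weight (F k) x) * P x = 0).
by rewrite frame_weight_core// subrr mul0r.
Qed.

Lemma partition_fun_eq0 k m x : frame_core (F k) x -> (k.+1 <= m)%N ->
  partition_fun m x = 0.
Proof.
move=> Fkx km; change (frame_weight (F m) x *
  (\prod_(j < m) (1 - frame_weight (F j)) : C) x = 0).
by rewrite (prod_core_eq0 Fkx) ?mulr0.
Qed.

(** The product left over by telescoping contains the factor [1 - frame_weight (F k)], which is 0 on
    the k-th core, so the sum needs no normalization. *)
Lemma partition_fun_sum1 k x : frame_core (F k) x ->
  \sum_(j < k.+1) partition_fun j x = 1.
Proof.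
move=> Fkx; rewrite -(smooth_sumE _ (fun j : 'I_k.+1 => partition_fun j)).
rewrite (sum_telescope_prod (fun j => frame_weight (F j))).
change (1 - (\prod_(j < k.+1) (1 - frame_weight (F j)) : C) x = 1).
by rewrite (prod_core_eq0 Fkx) ?subr0.
Qed.

End Partition.

End Glue.

(** * The connection *)

Section Connection.
Variables (R : realType) (n : nat) (M : manifold R n).
Local Notation C := (smooth_fun M).
Local Notation form := (form1 M).
Variable Pi : bivector M.

Definition form_app (X : forall x : M, tangent x) (sX : smooth_vector_field X) (a : form) : C :=
  mk_smooth (form1P a sX).

Lemma form_sumE (I : Type) (r : seq I) (a : I -> form) x :
  (\sum_(i <- r) a i : form) x = \sum_(i <- r) a i x.
Proof. by elim/big_rec2: _ => [//|i u v _ <-]. Qed.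

(** * The operator attached to one frame *)

Section Local.
Variable F : frame M.
Local Notation f := (frame_fun F).
Local Notation X := (frame_field F).

Definition frame_coord (i : 'I_n) (b : form) : C := form_app (frame_field_smooth F i) b.

Lemma frame_coordD i b b' : frame_coord i (b + b') = frame_coord i b + frame_coord i b'.
Proof. exact: smooth_fun_eq. Qed.

Lemma frame_coordZ i (g : C) b : frame_coord i (g *: b) = g * frame_coord i b.
Proof. exact: smooth_fun_eq. Qed.

(* [\sum_i a(X_i) L_(#df_i) b], where the Lie derivative along [#df_i] is
   computed in the coframe [df_j]; the first term uses
   [\sum_i a(X_i) {f_i, h} = Pi(a, dh)]. *)
Definition frame_deriv (a b : form) : form :=
  \sum_j (bivector_app Pi a (Defs.diff (frame_coord j b)) *: Defs.diff (f j)
    + frame_coord j b *: \sum_i frame_coord i a *: Defs.diff (bracket Pi (f i) (f j))).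

(** The value at [x] of [\sum_i a(X_i) L_(#df_i) df_j], since [L_(#df_i) df_j] is the differential
    of [{f_i, f_j}]. It depends on a covector at [x] only. *)
Definition frame_bracket (x : M) (a : cotangent x) (j : 'I_n) : cotangent x :=
  \sum_i a (X i x) *: diff_at x (bracket Pi (f i) (f j)).

Lemma frame_derivE a b x : frame_deriv a b x =
  \sum_j (Pi x (a x) (diff_at x (frame_coord j b)) *: diff_at x (f j)
    + b x (X j x) *: frame_bracket (a x) j).
Proof.
rewrite form_sumE; apply: eq_bigr => j _; congr (_ + _).
change (b x (X j x) *: (\sum_i frame_coord i a *: Defs.diff (bracket Pi (f i) (f j)) : form) x
  = b x (X j x) *: frame_bracket (a x) j).
by rewrite form_sumE.
Qed.

Lemma frame_deriv_linearl (g1 g2 : C) (a1 a2 b : form) x :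
  frame_deriv (g1 *: a1 + g2 *: a2) b x =
  g1 x *: frame_deriv a1 b x + g2 x *: frame_deriv a2 b x.
Proof.
rewrite !frame_derivE !scaler_sumr -big_split /=; apply: eq_bigr => j _.
change ((g1 *: a1 + g2 *: a2 : form) x) with (g1 x *: a1 x + g2 x *: a2 x).
have -> : frame_bracket (g1 x *: a1 x + g2 x *: a2 x) j =
    g1 x *: frame_bracket (a1 x) j + g2 x *: frame_bracket (a2 x) j.
  rewrite /frame_bracket !scaler_sumr -big_split /=; apply: eq_bigr => i _.
  by rewrite !scalerA -scalerDl.
rewrite bivectorLl bivectorZl scalerDl !scalerDr !scalerA addrACA.
by rewrite (mulrC (b x _) (g1 x)) (mulrC (b x _) (g2 x)).
Qed.

Lemma frame_derivD (a b1 b2 : form) x :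
  frame_deriv a (b1 + b2) x = frame_deriv a b1 x + frame_deriv a b2 x.
Proof.
rewrite !frame_derivE -big_split /=; apply: eq_bigr => j _.
change ((b1 + b2 : form) x (X j x)) with (b1 x (X j x) + b2 x (X j x)).
by rewrite frame_coordD diff_atD bivectorDr !scalerDl addrACA.
Qed.

Section AtFramePoint.
Variable x : M.
Hypothesis xF : frame_weight F x != 0.

Let near_expand (b : form) : \forall y \near x,
  b y = \sum_j frame_coord j b y *: diff_at y (f j).
Proof.
by apply: filterS (frame_near xF) => y fr; rewrite [LHS](cotangent_expand _ fr).
Qed.

Let expand (b : form) : b x = \sum_j frame_coord j b x *: diff_at x (f j).
Proof. exact: nbhs_singleton (near_expand b). Qed.

(** Applying [#a] to the coordinates [g b_j] creates the extra terms [#a(g) b_j df_j], which add up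
    to [#a(g) b] by the coframe expansion at [x]. *)
Lemma frame_deriv_leibniz (a : form) (g : C) (b : form) :
  frame_deriv a (g *: b) x = g x *: frame_deriv a b x + sharp Pi (a x) g *: b x.
Proof.
rewrite (expand b) !frame_derivE !scaler_sumr -big_split /=; apply: eq_bigr => j _.
change ((g *: b : form) x (X j x)) with (g x * b x (X j x)).
rewrite frame_coordZ diff_atM bivectorDr !bivectorZr sharpE scalerDl.
by rewrite !scalerDr !scalerA addrAC [frame_coord j b x * _]mulrC.
Qed.

(** Write [Pi(b, c)] as [\sum_j \sum_l b_j c_l {f_j, f_l}] near [x] and apply [#a]. The derivatives
    of [b_j] and [c_l] match the first terms of [frame_deriv], and that of [{f_j, f_l}] matches the
    bracket terms by Jacobi. *)
Lemma frame_deriv_parallel (a b c : form) : jacobi Pi ->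
  sharp Pi (a x) (bivector_app Pi b c) =
  Pi x (frame_deriv a b x) (c x) + Pi x (b x) (frame_deriv a c x).
Proof.
move=> J; set u := sharp Pi (a x).
have uP (h : C) : Pi x (a x) (diff_at x h) = u h by rewrite /u sharpE.
(* Expanding [a] in the coframe makes [u] the combination of the derivations [{f_i, _}] with
   coefficients [a(X_i)]; [jacobi_leibniz] applies to each. *)
have uB j l : u (bracket Pi (f j) (f l)) =
    Pi x (frame_bracket (a x) j) (diff_at x (f l))
    + Pi x (diff_at x (f j)) (frame_bracket (a x) l).
  rewrite /u sharpE {1}(expand a) bivector_suml /frame_bracket bivector_suml bivector_sumr.
  rewrite -big_split /=; apply: eq_bigr => i _.
  rewrite !bivectorZl bivectorZr -mulrDr; congr (_ * _).
  by have := congr1 (fun h : C => h x) (jacobi_leibniz J (f i) (f j) (f l)).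
(* The expansion of [Pi(b, c)] holds only near [x], which is all that the tangent vector [u]
   sees. *)
have -> : u (bivector_app Pi b c) =
    \sum_j \sum_l u (frame_coord j b * frame_coord l c * bracket Pi (f j) (f l)).
  under eq_bigr do rewrite -tangent_sum.
  rewrite -tangent_sum; apply: tangent_near_eq.
  apply: filterS2 (near_expand b) (near_expand c) => y bE cE.
  change (Pi y (b y) (c y) = (\sum_j \sum_l
    frame_coord j b * frame_coord l c * bracket Pi (f j) (f l) : C) y).
  rewrite {1}bE {1}cE smooth_sumE bivector_suml; apply: eq_bigr => j _.
  rewrite smooth_sumE bivector_sumr; apply: eq_bigr => l _.
  rewrite bivectorZl bivectorZr mulrA.
  by [].
have -> : Pi x (frame_deriv a b x) (c x) = \sum_j \sum_l
    (u (frame_coord j b) * frame_coord l c x * bracket Pi (f j) (f l) x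
     + frame_coord j b x * frame_coord l c x * Pi x (frame_bracket (a x) j) (diff_at x (f l))).
  rewrite frame_derivE {1}(expand c) bivector_suml; apply: eq_bigr => j _.
  rewrite bivector_sumr; apply: eq_bigr => l _.
  rewrite bivectorZr bivectorDl !bivectorZl uP bracketE.
  change (b x (X j x)) with (frame_coord j b x); ring.
have -> : Pi x (b x) (frame_deriv a c x) = \sum_j \sum_l
    (frame_coord j b x * u (frame_coord l c) * bracket Pi (f j) (f l) x
     + frame_coord j b x * frame_coord l c x * Pi x (diff_at x (f j)) (frame_bracket (a x) l)).
  rewrite frame_derivE {1}(expand b) bivector_suml; apply: eq_bigr => j _.
  rewrite bivector_sumr; apply: eq_bigr => l _.
  rewrite bivectorZl bivectorDr !bivectorZr uP bracketE.
  change (c x (X l x)) with (frame_coord l c x); ring.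
rewrite -big_split /=; apply: eq_bigr => j _.
rewrite -big_split /=; apply: eq_bigr => l _.
rewrite !tangentM uB.
change ((frame_coord j b * frame_coord l c : C) x) with (frame_coord j b x * frame_coord l c x).
change (c x (X l x)) with (frame_coord l c x).
change (b x (X j x)) with (frame_coord j b x).
by rewrite -bracketE; ring.
Qed.

End AtFramePoint.
End Local.

(** * Gluing the local operators *)

Section Global.
Variables (F : nat -> frame M) (N : M -> nat).
Hypothesis FN : forall x, frame_core (F (N x)) x.
Local Notation rho := (partition_fun F).

(** [N x] is the index of some core containing [x]; every [rho k] with [k > N x] vanishes at [x], so
    the truncated sum is the full one. *)
Definition glued_deriv_at (a b : form) (x : M) : cotangent x :=
  \sum_(k < (N x).+1) rho k x *: frame_deriv (F k) a b x.

(** [N] may jump from point to point, but on the core of index [N p] the sums up to [N y] and up to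
    [N p] agree, and the latter has a fixed number of smooth terms. *)
Lemma glued_deriv_smooth a b : smooth_covector_field (glued_deriv_at a b).
Proof.
move=> Y sY; apply: smooth_local => p.
pose g : C := \sum_(k < (N p).+1) rho k * form_app sY (frame_deriv (F k) a b).
exists (frame_core (F (N p))), g; split => //; [exact: frame_core_open|exact: smooth_funP|].
move=> y Fpy.
have -> : glued_deriv_at a b y (Y y) =
    \sum_(k < (N y).+1) rho k y * frame_deriv (F k) a b y (Y y).
  by rewrite /glued_deriv_at; elim/big_rec2: _ => [//|i u v _ <-].
rewrite smooth_sumE.
apply: (@sum_ord_stable R^o (fun k => rho k y * frame_deriv (F k) a b y (Y y))) => k Nk.
  by rewrite (partition_fun_eq0 (FN y) Nk) mul0r.
by rewrite (partition_fun_eq0 Fpy Nk) mul0r.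
Qed.

Definition glued_deriv (a b : form) : form := Form1 (glued_deriv_smooth a b).

(** Weights of sum 1 preserve a common inhomogeneous term [t], and the local identity is required
    only for frames that are valid at [x]. In the Leibniz rule, [t] is [#a(g) b]. *)
Lemma glued_ind (x : M) (V : lmodType R) (t : V) (G H : nat -> V) :
  (forall k, frame_weight (F k) x != 0 -> G k = H k + t) ->
  \sum_(k < (N x).+1) rho k x *: G k = \sum_(k < (N x).+1) rho k x *: H k + t.
Proof.
move=> GH; pose r k : R := rho k x.
have r1 : \sum_(k < (N x).+1) r k = 1 := partition_fun_sum1 (FN x).
change (\sum_(k < (N x).+1) r k *: G k = \sum_(k < (N x).+1) r k *: H k + t).
rewrite -[X in _ + X]scale1r -r1 scaler_suml -big_split /=.
apply: eq_bigr => k _; rewrite -scalerDr.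
have [->|rk] := eqVneq (r k) 0; first by rewrite !scale0r.
by rewrite GH//; exact: partition_fun_neq0 rk.
Qed.

Lemma glued_deriv_linearl (g1 g2 : C) (a1 a2 b : form) :
  glued_deriv (g1 *: a1 + g2 *: a2) b = g1 *: glued_deriv a1 b + g2 *: glued_deriv a2 b.
Proof.
apply: form1_eq => x; change (glued_deriv_at (g1 *: a1 + g2 *: a2) b x =
  g1 x *: glued_deriv_at a1 b x + g2 x *: glued_deriv_at a2 b x).
rewrite /glued_deriv_at !scaler_sumr -big_split /=; apply: eq_bigr => k _.
by rewrite frame_deriv_linearl scalerDr !scalerA ![rho k x * _]mulrC.
Qed.

Lemma glued_derivD (a b1 b2 : form) :
  glued_deriv a (b1 + b2) = glued_deriv a b1 + glued_deriv a b2.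
Proof.
apply: form1_eq => x; change (glued_deriv_at a (b1 + b2) x =
  glued_deriv_at a b1 x + glued_deriv_at a b2 x).
rewrite /glued_deriv_at -big_split /=; apply: eq_bigr => k _.
by rewrite frame_derivD scalerDr.
Qed.

Lemma glued_deriv_leibniz (a : form) (g : C) (b : form) (x : M) :
  glued_deriv a (g *: b) x = g x *: glued_deriv a b x + sharp Pi (a x) g *: b x.
Proof.
rewrite /= /glued_deriv_at scaler_sumr.
under [in RHS]eq_bigr => k _ do rewrite scalerA mulrC -scalerA.
apply: (glued_ind (G := fun k => frame_deriv (F k) a (g *: b) x)
  (H := fun k => g x *: frame_deriv (F k) a b x)) => k xk.
exact: frame_deriv_leibniz.
Qed.

Lemma glued_derivZ (a : form) (k : R) (b : form) :
  glued_deriv a (smooth_const M k *: b) = smooth_const M k *: glued_deriv a b.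
Proof.
apply: form1_eq => x; rewrite glued_deriv_leibniz tangent_const scale0r addr0.
by [].
Qed.

Definition glued_connection : contravariant_derivative Pi :=
  ContravariantDerivative glued_deriv_linearl glued_derivD glued_derivZ glued_deriv_leibniz.

(** By bilinearity of Pi the two connection terms are an average over [k] of the local ones, each of
    which adds up to the same number [u]. *)
Lemma glued_connection_parallel (a b c : form) (x : M) : jacobi Pi ->
  cderiv_bivector glued_connection a Pi b c x = 0.
Proof.
move=> J; rewrite /cderiv_bivector.
set u := sharp Pi (a x) (bivector_app Pi b c).
change (u - Pi x (glued_deriv_at a b x) (c x) - Pi x (b x) (glued_deriv_at a c x) = 0).
pose r k : R := rho k x.
have r1 : \sum_(k < (N x).+1) r k = 1 := partition_fun_sum1 (FN x).
have -> d : glued_deriv_at a d x = \sum_(k < (N x).+1) r k *: frame_deriv (F k) a d x by [].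
rewrite bivector_suml bivector_sumr.
rewrite -addrA -opprD -big_split /=; apply/eqP; rewrite subr_eq0 eq_sym; apply/eqP.
rewrite -[RHS]mul1r -r1 mulr_suml; apply: eq_bigr => k _.
rewrite bivectorZl bivectorZr -mulrDr.
have [->|rk] := eqVneq (r k) 0; first by rewrite !mul0r.
by congr (_ * _); rewrite -frame_deriv_parallel//; exact: partition_fun_neq0 rk.
Qed.

End Global.
End Connection.

Theorem proposition2p5p1 (R : realType) (n : nat) (M : poisson_manifold R n) :
  exists D : contravariant_derivative (poisson_bivector M),
    forall (a b c : form1 M) (x : M),
      cderiv_bivector D a (poisson_bivector M) b c x = 0.
Proof.
have [F FM] := frame_cover M; have [N FN] := choice FM.
exists (glued_connection (poisson_bivector M) FN) => a b c x.
exact/glued_connection_parallel/poisson_jacobi.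
Qed.
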